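(* Let $L$ be a Laplacian on $[n]$, let $\mathcal I\subset[n]$ be nonempty, and let $t>0$. Let $P(t)=e^{-Lt}$, let $P^{\mathrm{sp}}_{\mathcal I}(t)$ be the structure-preserving compression, and let $\varepsilon_*(\mathcal I)$ be the nuclear norm Nyström error (all defined in the context). Then $$\|P^{\mathrm{sp}}_{\mathcal I}(t)-P(t)\|_*\le\Big(\frac{3\sqrt3}{2\pi}+|\mathcal I|\,\frac{2}{\pi}\Big)\frac{\varepsilon_*(\mathcal I)}{t}.$$
   Context: Let $[n]=\{1,\dots,n\}$. Let $R\in\mathbb{R}^{n\times n}$ be the rate matrix of an irreducible reversible continuous-time Markov chain $(X_t)_{t\ge0}$ on $[n]$: $R_{i,j}\ge 0$ for $i\ne j$, $R\mathbf 1=\mathbf 0$, $R$ irreducible, with unique (entrywise positive) stationary distribution $\pi$, $\mathbf 1^\top\pi=1$, $R^\top\pi=\mathbf 0$, and $\mathrm{diag}(\pi)R=R^\top\mathrm{diag}(\pi)$. Put $h:=\pi^{1/2}$ (entrywise) and $L:=-\mathrm{diag}(h)\,R\,\mathrm{diag}(h)^{-1}$. A ''Laplacian'' is any matrix $L$ arising this way; it is symmetric positive semidefinite with one-dimensional null space spanned by $h$. For $\mathcal S\subset[n]$ let $\tau_{\mathcal S}:=\min\{t\ge0:X_t\in\mathcal S\}$. The committor matrix $\tilde C\in\mathbb R^{n\times|\mathcal I|}$ is $\tilde C_{i,j}:=\mathbb P(X_{\tau_{\mathcal I}}=j\mid X_0=i)$ for $i\in[n]$, $j\in\mathcal I$.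 Put $\hat\pi:=\tilde C^\top\pi$, $\hat h:=\hat\pi^{1/2}$ (entrywise), $C:=\mathrm{diag}(h)\,\tilde C\,\mathrm{diag}(\hat h)^{-1}$, $\hat L:=C^\top LC$. The structure-preserving compression is $P^{\mathrm{sp}}_{\mathcal I}(t):=Ce^{-\hat Lt}C^\top$. For $\gamma>0$ let $K_\gamma:=(L+\gamma\mathbf I)^{-1}$. Then $$\varepsilon_*(\mathcal I):=\lim_{\gamma\to0^+}\big\|K_\gamma-(K_\gamma)_{:,\mathcal I}(K_\gamma)_{\mathcal I,\mathcal I}^{-1}(K_\gamma)_{\mathcal I,:}\big\|_*$$ (the limit exists), where $\|\cdot\|_*$ is the nuclear norm (sum of singular values). *)

(* Defs.v *)
(* MathComp-Analysis *)
From mathcomp Require Import all_boot all_order all_algebra.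
From mathcomp Require Import all_classical all_reals all_analysis.
From mathcomp Require Import polyrcf.

Set Implicit Arguments.
Unset Strict Implicit.
Unset Printing Implicit Defensive.

Import Order.TTheory GRing.Theory Num.Theory numFieldNormedType.Exports.

Local Open Scope classical_set_scope.
Local Open Scope ring_scope.

Section Matrices.
Variable R : realType.

Definition expm n (A : 'M[R]_n) : 'M[R]_n :=
  limn (series (fun k : nat => k`!%:R^-1 *: A ^+ k)).

(* Square roots of the eigenvalues of A^T A, repeated according to algebraic
   multiplicity (rootsR lists the distinct real roots). For m < n this has
   n - m more zeros than the convention with min(m, n) singular values. *)
Definition singular_values m n (A : 'M[R]_(m, n)) : seq R :=
  let p := char_poly (A^T *m A) in
  flatten [seq nseq (mup x p) (Num.sqrt x) | x <- rootsR p].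

Definition nuclear_norm m n (A : 'M[R]_(m, n)) : R :=
  \sum_(s <- singular_values A) s.

End Matrices.

Section Rates.
Variables (R : realType) (n : nat).
Implicit Types (Q L : 'M[R]_n) (mu : 'rV[R]_n) (I : {set 'I_n}).

Definition is_rate_matrix Q : Prop :=
  (forall i j, i != j -> 0 <= Q i j) /\ Q *m const_mx 1 = 0 :> 'cV[R]_n.

(* The diagonal of a rate matrix is nonpositive, so it gives no edge. *)
Definition irreducible_rates Q : Prop :=
  forall i j, connect [rel k l | 0 < Q k l] i j.

(* Distributions are row vectors: mu *m Q = 0 is Q^T mu^T = 0. *)
Definition is_stationary Q mu : Prop :=
  [/\ forall i, 0 < mu 0 i, \sum_i mu 0 i = 1 & mu *m Q = 0].

Definition is_reversible Q mu : Prop :=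
  diag_mx mu *m Q = Q^T *m diag_mx mu.

Definition laplacian Q mu : 'M[R]_n :=
  let h := map_mx Num.sqrt mu in
  - (diag_mx h *m Q *m invmx (diag_mx h)).

Definition shifted_inverse L (g : R) : 'M[R]_n := invmx (L + g%:M).

(* The columns indexed by I are numbered by 'I_#|I| through enum_val. *)
Definition nystrom_residual (K : 'M[R]_n) I : 'M[R]_n :=
  let e : 'I_#|I| -> 'I_n := enum_val in
  K - colsub e K *m invmx (mxsub e e K) *m rowsub e K.

Definition nystrom_error L I : R :=
  lim (nuclear_norm (nystrom_residual (shifted_inverse L g) I) @[g --> 0^'+]).

End Rates.

Section Chain.
Variables (R : realType) (n : nat) (d : measure_display) (T : measurableType d).
Implicit Types (P : probability T R) (X : R -> T -> 'I_n) (I : {set 'I_n}).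

(* The process is indexed by R, but only its values at times t >= 0 matter.
   The last clause is the Markov property
     Pr[X(t_k+1) = i_k+1 | X(t_l) = i_l for l <= k]
       = (exp ((t_k+1 - t_k) Q))(i_k, i_k+1)
   cleared of denominators, which covers null conditioning events. *)
Definition is_markov_chain P X (Q : 'M[R]_n) : Prop :=
  [/\ forall t i, 0 <= t -> measurable [set w | X t w = i],
      forall w t, 0 <= t -> \forall s \near t^'+, X s w = X t w
    & forall (k : nat) (t : nat -> R) (i : nat -> 'I_n),
        0 <= t 0%N -> (forall l, (l <= k)%N -> t l <= t l.+1) ->
        P [set w | forall l, (l <= k.+1)%N -> X (t l) w = i l] =
        (P [set w | forall l, (l <= k)%N -> X (t l) w = i l] *
         (expm ((t k.+1 - t k) *: Q) (i k) (i k.+1))%R%:E)%E].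

Definition is_hitting_time X I (w : T) (t : R) : Prop :=
  [/\ 0 <= t, X t w \in I & forall s, 0 <= s -> X s w \in I -> t <= s].

(* The event that I is hit (in finite time), and first at state j. *)
Definition hits_at X I (j : 'I_n) : set T :=
  [set w | exists2 t, is_hitting_time X I w t & X t w = j].

Definition cond_prob P (A B : set T) : R := fine (P (A `&` B)) / fine (P B).

Definition committor P X I : 'M[R]_(n, #|I|) :=
  \matrix_(i, j) cond_prob P (hits_at X I (enum_val j)) [set w | X 0 w = i].

Definition weighted_committor P X (mu : 'rV[R]_n) I : 'M[R]_(n, #|I|) :=
  let Ct := committor P X I in
  let h := map_mx Num.sqrt mu in
  let hhat := map_mx Num.sqrt (mu *m Ct) in
  diag_mx h *m Ct *m invmx (diag_mx hhat).

Definition sp_compression P X (Q : 'M[R]_n) (mu : 'rV[R]_n) I (t : R) :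
    'M[R]_n :=
  let C := weighted_committor P X mu I in
  let Lhat := C^T *m laplacian Q mu *m C in
  C *m expm (- t *: Lhat) *m C^T.

End Chain.

(* Main.v *)
Require Import Defs.
From mathcomp Require Import all_boot all_order all_algebra.
From mathcomp Require Import all_classical all_reals all_analysis.
From mathcomp Require Import polyrcf complex ring lra.
Import Order.TTheory GRing.Theory Num.Theory numFieldNormedType.Exports.
Local Open Scope classical_set_scope.
Local Open Scope ring_scope.

(** Let [J] be the complement of [I], and [D0] the inverse of the block [L_JJ]
    padded by zeros. The Nystrom residual of [(L + g)^-1] is the padded inverse
    of [L_JJ + g], so the Nystrom error is [eps = tr D0].

    The columns of [C] are [L]-harmonic on [J]; hence, with [Lhat = C^T L C] and
    a matrix [G] supported on the rows in [I], [L C = G Lhat] and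
    [L D0 = 1 - G C^T]. Two operators drive the error: [D0], and the defect
    [N = 1 - C^T C], which is the average over the starting point of the
    variance of the state first hit in [I]. For each [l] in [J] this variance
    times the capacity [mu_l / (D0)_ll] between [l] and [I] is at most the
    Dirichlet energy, and summing over [l] gives [N <= eps Lhat].

    Test the error against an orthogonal [U] and follow [e^(-sL) C e^(-(t-s)Lhat)]
    from [s = 0] to [s = t]. The part of the derivative that contains [D0] is
    bounded by [tr D0] times operator norms, after an integration by parts near
    both ends. The part that contains [N] is made of products of two functions
    square integrable in time and has rank at most [|I| - 1].

    The committor is harmonic because it is the limit of the hitting
    probabilities of the chain observed on the grids [Z/k]: by right continuity
    the first hit on a fine enough grid is at the state first hit by the path. *)

(** The argument yields [eps / t] times [9/(4e) + 41/(10 e^2) + (|I| - 1)/2], which does not have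
    the shape of the claim. At [|I| = 1] this factor is about 1.38 against 1.46, and its slope 1/2
    in [|I|] is below [2/pi]; with [|I|] in place of [|I| - 1] the comparison would fail for small
    [I]. The lost unit is the null vector of [Lhat], which [N <= eps Lhat] forces into the kernel of
    [N].

    The obstacle is that [C] does not intertwine the two generators, since [G] differs from [C].
    Applying [L D0 = 1 - G C^T] to [C] gives [C - G = L D0 C - G N], hence
    [C Lhat - L C = L (D0 C) Lhat - G N Lhat]. So [D0] stands between two factors without uniform
    bound, and each costs an inverse time once multiplied by its semigroup. The matrix [G N] is read
    as [L C Lhat^-1 N], and [N <= eps Lhat] then pays for the inverse.

    The slope 1/2 comes from time integrals that equal 1/2 for every positive eigenvalue, whatever
    its size. *)

Set Implicit Arguments.
Unset Strict Implicit.
Unset Printing Implicit Defensive.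

(** * Spectral theorem for real symmetric matrices *)

Section Spectral.
Variable R : rcfType.

Lemma mxtrace11 (A : 'M[R]_1) : \tr A = A 0 0.
Proof. by rewrite /mxtrace big_ord1. Qed.

Lemma mulmxTE m n (u : 'M[R]_(m, n)) i : (u^T *m u) i i = \sum_k u k i ^+ 2.
Proof. by rewrite mxE; apply: eq_bigr => k _; rewrite mxE expr2. Qed.

Lemma mulmxT_eq0 n (u : 'cV[R]_n) : ((u^T *m u) 0 0 == 0) = (u == 0).
Proof.
rewrite mulmxTE psumr_eq0; last by move=> k _; exact: sqr_ge0.
apply/allP/eqP => [u0|-> k _]; last by rewrite /= mxE expr0n /= eqxx.
apply/colP => k; rewrite mxE; apply/eqP.
by rewrite -sqrf_eq0; exact: (u0 k (mem_index_enum k)).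
Qed.

(* The real and imaginary parts of a complex eigenvector are eigenvectors,
   since the eigenvalue is real. *)
Lemma symmetric_eigenvector n (A : 'M[R]_n.+1) : A^T = A ->
  exists2 v : 'cV[R]_n.+1, v^T *m v = 1%:M & exists l : R, A *m v = l *: v.
Proof.
move=> symA; pose Ac := map_mx (@real_complex R) A.
have [l /eigenvalueP[v vA v0]] := eigenvalue_closed Ac (ltn0Sn n).
pose a := (map_mx (@complex.Re R) v)^T; pose b := (map_mx (@complex.Im R) v)^T.
pose lr := complex.Re l; pose li := complex.Im l.
have [Aa Ab] : A *m a = lr *: a - li *: b /\ A *m b = lr *: b + li *: a.
  have vAi i : \sum_k v 0 k * (A k i)%:C%C = l * v 0 i.
    by move: vA => /rowP/(_ i); rewrite !mxE => <-; apply: eq_bigr => k _; rewrite !mxE.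
  have reS := raddf_sum (@complex.Re R); have imS := raddf_sum (@complex.Im R).
  split; apply/colP => i; rewrite !mxE.
    have := congr1 (@complex.Re R) (vAi i); rewrite reS => e.
    transitivity (complex.Re (l * v 0 i)); last first.
      by rewrite /lr /li; case: (l) => ? ?; case: (v 0 i).
    rewrite -e; apply: eq_bigr => k _; rewrite !mxE -{1}symA mxE.
    by case: (v 0 k) => p q /=; rewrite mulr0 subr0 mulrC.
  have := congr1 (@complex.Im R) (vAi i); rewrite imS => e.
  transitivity (complex.Im (l * v 0 i)); last first.
    by rewrite /lr /li; case: (l) => ? ?; case: (v 0 i).
  rewrite -e; apply: eq_bigr => k _; rewrite !mxE -{1}symA mxE.
  by case: (v 0 k) => p q /=; rewrite mulr0 add0r mulrC.
have ab0 : (a != 0) || (b != 0).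
  rewrite -negb_and; apply: contra v0 => /andP[/eqP a0 /eqP b0].
  apply/eqP/rowP => i; rewrite mxE; apply/eqP; rewrite eq_complex.
  move: a0 => /colP/(_ i); move: b0 => /colP/(_ i); rewrite !mxE => -> ->.
  by rewrite eqxx.
clearbody a b.
have sq_ge0 (u : 'cV[R]_n.+1) : 0 <= (u^T *m u) 0 0.
  by rewrite mulmxTE sumr_ge0 // => k _; exact: sqr_ge0.
(* Symmetry equates [b^T A a] with [a^T A b]; expanding both by [Aa] and [Ab] leaves
   [li * (|a|^2 + |b|^2) = 0]. *)
have li0 : li = 0.
  have : \tr (b^T *m (A *m a)) = \tr (a^T *m (A *m b)).
    by rewrite -[LHS]mxtrace_tr !trmx_mul !trmxK symA mulmxA.
  rewrite Aa Ab mulmxBr mulmxDr -!scalemxAr mxtraceD raddfB /= !mxtraceZ.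
  rewrite (_ : \tr (b^T *m a) = \tr (a^T *m b)); last first.
    by rewrite -[LHS]mxtrace_tr trmx_mul trmxK.
  move=> e; have : li * ((a^T *m a) 0 0 + (b^T *m b) 0 0) = 0.
    by rewrite -!mxtrace11; lra.
  move/eqP; rewrite mulf_eq0 => /orP[/eqP //|].
  rewrite paddr_eq0 // !mulmxT_eq0.
  by case/orP: ab0 => /negbTE -> //; rewrite andbF.
rewrite li0 !scale0r subr0 addr0 in Aa Ab.
have normalize (u : 'cV[R]_n.+1) : u != 0 -> A *m u = lr *: u ->
    exists2 v : 'cV[R]_n.+1, v^T *m v = 1%:M & exists l : R, A *m v = l *: v.
  move=> u0 Au; pose c := Num.sqrt ((u^T *m u) 0 0).
  exists (c^-1 *: u); last by exists lr; rewrite -scalemxAr Au !scalerA mulrC.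
  rewrite -scalemxAr [(_ *: u)^T]linearZ /= -scalemxAl scalerA [u^T *m u]mx11_scalar.
  rewrite scale_scalar_mx -expr2 exprVn sqr_sqrtr // mulVf // mulmxT_eq0 //.
by case/orP: ab0 => [/normalize|/normalize]; apply.
Qed.

(** Deflation: conjugating by [H] moves the eigenvector [v] to the first basis vector. As [H] is its
    own transpose and inverse, the conjugate stays symmetric. *)
Lemma orthogonal_first_column n (v : 'cV[R]_(1 + n)) : v^T *m v = 1%:M ->
  exists2 H : 'M[R]_(1 + n), H^T = H & H *m H = 1%:M /\ H *m delta_mx 0 0 = v.
Proof.
move=> v1; pose e : 'cV[R]_(1 + n) := delta_mx 0 0.
have [->|ve] := eqVneq v e.
  by exists 1%:M; rewrite ?trmx1 // !mul1mx.
pose w := v - e; pose q := (w^T *m w) 0 0.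
have q0 : q != 0 by rewrite mulmxT_eq0 subr_eq0.
have ww : w^T *m w = q%:M by exact: mx11_scalar.
have ee : e^T *m e = 1%:M.
  rewrite trmx_delta mul_delta_mx; apply/matrixP => i j.
  by rewrite !ord1 !mxE.
have ve_sym : v^T *m e = e^T *m v.
  by rewrite -[LHS]trmxK trmx_mul trmxK [LHS]mx11_scalar [RHS]mx11_scalar !mxE.
have we : w^T *m e = (- (q / 2))%:M.
  have: q%:M = 2 *: (1%:M - v^T *m e) :> 'M[R]_1.
    rewrite -ww /w [(v - e)^T]linearB /= mulmxBl !mulmxBr v1 ee ve_sym scaler_nat mulr2n.
    by rewrite opprB addrA addrAC -addrA.
  move=> eq1; rewrite /w [(v - e)^T]linearB /= mulmxBl ee -opprB.
  rewrite -[1%:M - _](scalerK (_ : 2 != 0 :> R)) // -eq1 scale_scalar_mx.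
  by rewrite mulrC -raddfN.
(* Householder reflection exchanging [e] and [v] *)
exists (1%:M - (2 / q) *: (w *m w^T)).
  by rewrite [LHS]linearB /= trmx1 [(_ *: _)^T]linearZ /= trmx_mul trmxK.
split; last first.
  rewrite mulmxBl mul1mx -scalemxAl -mulmxA we mul_mx_scalar scalerA.
  rewrite mulrN -/e (_ : 2 / q * (q / 2) = 1); last by field.
  by rewrite scaleN1r opprK /w addrC subrK.
pose S := w *m w^T; have SS : S *m S = q *: S.
  by rewrite /S mulmxA -(mulmxA w) ww mul_mx_scalar -scalemxAl.
rewrite -/S mulmxBl mul1mx mulmxBr mulmx1 -scalemxAr -scalemxAl SS.
rewrite [2 / q *: (q *: S)]scalerA divfK // scaler_nat mulr2n scalerDr.
by rewrite opprB addrK subrK.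
Qed.

Theorem symmetric_diagonalization n (A : 'M[R]_n) : A^T = A ->
  exists2 O : 'M[R]_n, O^T *m O = 1%:M &
  exists l : 'rV[R]_n, A = O^T *m diag_mx l *m O.
Proof.
elim: n A => [|n IHn] A symA.
  by exists 1%:M; [rewrite [LHS]flatmx0 [RHS]flatmx0|exists 0; rewrite [LHS]flatmx0 [RHS]flatmx0].
have [v v1 [l Av]] := symmetric_eigenvector symA.
have [H HT [HH Hv]] := orthogonal_first_column v1.
have [B BE] : exists B : 'M[R]_(1 + n), B = H *m A *m H by exists (H *m A *m H).
have BT : B^T = B by rewrite BE !trmx_mul symA HT mulmxA.
have Be : B *m delta_mx 0 0 = l *: (delta_mx 0 0 : 'cV_(1 + n)).
  rewrite BE -!mulmxA Hv Av -scalemxAr; congr (_ *: _).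
  by rewrite -Hv mulmxA HH mul1mx.
have B0 i : B i 0 = l *+ (i == 0).
  have := congr1 (fun u : 'cV_(1 + n) => u i 0) Be.
  by rewrite -colE !mxE eqxx andbT => ->; rewrite mulr_natr.
have [P O1 [d Bd]] : exists2 O : 'M[R]_n, O^T *m O = 1%:M &
    exists l : 'rV[R]_n, drsubmx B = O^T *m diag_mx l *m O.
  by apply: IHn; rewrite trmx_drsub BT.
have l0 : lshift n (0 : 'I_1) = 0 by exact: val_inj.
have defB : B = block_mx l%:M 0 0 (drsubmx B).
  rewrite -[LHS]submxK; congr block_mx; apply/matrixP => i j.
  - by rewrite !ord1 !mxE l0 B0.
  - by rewrite !mxE -BT mxE ord1 l0 B0 -val_eqE /= mulr0n.
  - by rewrite !mxE ord1 l0 B0 -val_eqE /= mulr0n.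
pose O2 : 'M[R]_(1 + n) := block_mx 1%:M 0 0 P.
have O2O : O2^T *m O2 = 1%:M.
  rewrite /O2 tr_block_mx mulmx_block !trmx1 !trmx0 !mulmx0 !mul0mx mul1mx.
  by rewrite addr0 !add0r O1 -scalar_mx_block.
exists (O2 *m H); first by rewrite trmx_mul HT -mulmxA (mulmxA O2^T) O2O mul1mx.
have DE : B = O2^T *m diag_mx (row_mx l%:M d) *m O2.
  rewrite {1}defB Bd /O2 tr_block_mx diag_mx_row !mulmx_block.
  rewrite !trmx1 !trmx0 !mulmx0 !mul0mx !mul1mx !mulmx1 !addr0 !add0r.
  congr block_mx; rewrite ?mul0mx ?mulmx0 //; apply/matrixP => i j.
  by rewrite !ord1 !mxE.
exists (row_mx l%:M d).
have -> : A = H *m B *m H by rewrite BE !mulmxA HH mul1mx -mulmxA HH mulmx1.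
by rewrite {1}DE trmx_mul HT !mulmxA.
Qed.

End Spectral.

(** * Nuclear norm of a symmetric matrix *)

Section Nuclear.
Variable R : realType.

Lemma char_poly_similar n (P Q A : 'M[R]_n) : P *m Q = 1%:M ->
  char_poly (P *m A *m Q) = char_poly A.
Proof.
move=> PQ; pose mp := map_mx (@polyC R).
have mPQ : mp _ _ P *m mp _ _ Q = 1%:M by rewrite -map_mxM PQ map_mx1.
rewrite /char_poly /char_poly_mx.
have -> : 'X%:M - mp _ _ (P *m A *m Q) =
    mp _ _ P *m ('X%:M - mp _ _ A) *m mp _ _ Q.
  rewrite mulmxBr mulmxBl -!map_mxM; congr (_ - _).
  by rewrite mul_mx_scalar -scalemxAl mPQ scale_scalar_mx mulr1.
rewrite !det_mulmx mulrAC -det_mulmx mPQ det1 mul1r //.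
Qed.

Lemma char_poly_diag n (l : 'rV[R]_n) :
  char_poly (diag_mx l) = \prod_(i < n) ('X - (l 0 i)%:P).
Proof.
rewrite char_poly_trig ?diag_mx_is_trig //.
by apply: eq_bigr => i _; rewrite mxE eqxx mulr1n.
Qed.

(** The characteristic polynomial of [A^T A] is the product of the ['X - l_i^2], so its roots listed
    with multiplicity are a permutation of the squares of the [l_i]. *)
Lemma nuclear_norm_diag n (A W : 'M[R]_n) (l : 'rV[R]_n) :
  W^T *m W = 1%:M -> A = W^T *m diag_mx l *m W ->
  nuclear_norm A = \sum_i `|l 0 i|.
Proof.
move=> WW AE; pose s := [seq l 0 i ^+ 2 | i <- enum 'I_n].
have pE : char_poly (A^T *m A) = \prod_(x <- s) ('X - x%:P).
  have WW' : W *m W^T = 1%:M by exact: mulmx1C.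
  have -> : A^T *m A = W^T *m diag_mx (\row_i (l 0 i ^+ 2)) *m W.
    rewrite AE !trmx_mul tr_diag_mx trmxK !mulmxA; congr (_ *m W).
    rewrite -(mulmxA _ W) WW' mulmx1 -(mulmxA _ (diag_mx l)); congr (_ *m _).
    apply/matrixP => i j; rewrite mul_diag_mx !mxE.
    by case: eqP => _; rewrite ?mulr1n ?expr2 // !mulr0n mulr0.
  rewrite char_poly_similar // char_poly_diag /s big_map big_enum /=.
  by apply: eq_bigr => i _; rewrite mxE.
have p0 : \prod_(x <- s) ('X - x%:P) != 0.
  by rewrite monic_neq0 // monic_prod_XsubC.
rewrite /nuclear_norm /singular_values pE.
set p := \prod_(x <- s) _ in p0 *.
transitivity (\sum_(x <- s) Num.sqrt x); last first.
  by rewrite big_map big_enum /=; apply: eq_bigr => i _; rewrite sqrtr_sqr.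
rewrite -[RHS](big_map Num.sqrt xpredT id); apply: perm_big.
have -> : flatten [seq nseq (mup x p) (Num.sqrt x) | x <- rootsR p] =
  [seq Num.sqrt x | x <- flatten [seq nseq (mup x p) x | x <- rootsR p]].
  by rewrite map_flatten -map_comp; congr flatten; apply: eq_map => x /=; rewrite map_nseq.
apply: perm_map; apply/allP => x _ /=; rewrite -[count_mem x s]mu_prod_XsubC -/p.
have ur : uniq (rootsR p) by rewrite uniq_roots.
have : (x \in rootsR p) = root p x.
  by have := roots_on_rootsR p0 x; rewrite in_itv.
elim: (rootsR p) ur => [|y r IHr] /= => [_|/andP[yr ur]].
  by rewrite in_nil => rx; rewrite mupNroot // -rx.
rewrite in_cons count_cat count_nseq /= => H.
have [xy|xy] := eqVneq x y.
  subst y; rewrite mul1n (_ : count_mem x _ = 0%N) ?addn0 //.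
  apply/count_memPn; apply: contra yr => /flattenP[t /mapP[z zr ->]].
  by rewrite mem_nseq => /andP[_ /eqP ->].
by rewrite mul0n add0n; apply: IHr => //; rewrite -H (negbTE xy).
Qed.

Lemma nuclear_norm_trace n (A : 'M[R]_n) : A^T = A ->
  exists2 U : 'M[R]_n, U^T *m U = 1%:M & nuclear_norm A = \tr (U *m A).
Proof.
move=> /symmetric_diagonalization[W WW [l AE]].
have WW' : W *m W^T = 1%:M by exact: mulmx1C.
(* A zero eigenvalue gets sign 1 rather than 0, so that [U] is orthogonal even for singular [A]. *)
pose sg := \row_i (if 0 <= l 0 i then 1 else -1 : R).
have sg2 : diag_mx sg *m diag_mx sg = 1%:M.
  apply/matrixP => i j; rewrite mul_diag_mx !mxE.
  by case: eqP => // _; case: ifP => _; rewrite ?mulr0n ?mulr0 ?mulr1n ?mulrNN ?mulr1.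
exists (W^T *m diag_mx sg *m W).
  rewrite !trmx_mul tr_diag_mx trmxK !mulmxA -(mulmxA _ W) WW' mulmx1.
  by rewrite -(mulmxA _ (diag_mx sg) (diag_mx sg)) sg2 mulmx1.
rewrite (nuclear_norm_diag WW AE) AE.
rewrite !mulmxA -(mulmxA _ W) WW' mulmx1 mxtrace_mulC !mulmxA WW' mul1mx.
rewrite /mxtrace; apply: eq_bigr => i _; rewrite mul_diag_mx !mxE eqxx !mulr1n.
case: ifP => [l0|/negbT l0]; first by rewrite mul1r ger0_norm.
by rewrite mulN1r ltr0_norm // ltNge.
Qed.

End Nuclear.

(** * Exponential of a diagonalizable matrix *)

Section Expm.
Variable R : realType.

Lemma diag_mx_sum n (l : 'rV[R]_n) : diag_mx l = \sum_k l 0 k *: delta_mx k k.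
Proof.
apply/matrixP => i j; rewrite summxE (bigD1 i) //= big1 ?addr0 => [|k ki].
  by rewrite !mxE eqxx andTb eq_sym mulr_natr.
by rewrite !mxE eq_sym (negbTE ki) mulr0.
Qed.

Lemma diag_conj_sum n (P Q : 'M[R]_n) (l : 'rV[R]_n) :
  P *m diag_mx l *m Q = \sum_k l 0 k *: (P *m delta_mx k k *m Q).
Proof.
rewrite diag_mx_sum mulmx_sumr mulmx_suml; apply: eq_bigr => k _.
by rewrite -scalemxAr -scalemxAl.
Qed.

Lemma exp_diag_conj n (P Q A : 'M[R]_n) (l : 'rV[R]_n) k :
  P *m Q = 1%:M -> A = P *m diag_mx l *m Q ->
  A ^+ k = P *m diag_mx (map_mx (fun x => x ^+ k) l) *m Q.
Proof.
move=> PQ AE; elim: k => [|k IHk].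
  rewrite expr0 (_ : map_mx _ l = const_mx 1); last by apply/matrixP => i j; rewrite !mxE.
  by rewrite diag_const_mx mulmx1 PQ.
rewrite exprS IHk AE -[LHS]/(_ *m _) !mulmxA; congr (_ *m _).
rewrite -(mulmxA _ Q) (mulmx1C PQ) mulmx1 -mulmxA; congr (_ *m _).
apply/matrixP => i j; rewrite mul_diag_mx !mxE.
by case: eqP => [->|_]; rewrite ?mulr1n ?exprS // !mulr0n mulr0.
Qed.

(** Along the rank-one matrices [P *m delta_mx i i *m Q] the matrix series splits into finitely many
    scalar exponential series. *)
Lemma cvg_expm_diag n (P Q A : 'M[R]_n) (l : 'rV[R]_n) :
  P *m Q = 1%:M -> A = P *m diag_mx l *m Q ->
  series (fun k => k`!%:R^-1 *: A ^+ k) @ \oo -->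
    P *m diag_mx (map_mx expR l) *m Q.
Proof.
move=> PQ AE.
have -> : series (fun k => k`!%:R^-1 *: A ^+ k) =
    (fun N => \sum_(i < n) series (exp_coeff (l 0 i)) N *: (P *m delta_mx i i *m Q)).
  apply/funext => N; rewrite /series /=.
  under eq_bigr do rewrite (exp_diag_conj _ PQ AE) diag_conj_sum scaler_sumr.
  rewrite exchange_big /=; apply: eq_bigr => i _; rewrite scaler_suml.
  by apply: eq_bigr => k _; rewrite mxE scalerA /exp_coeff mulrC.
rewrite diag_conj_sum; apply: cvg_big => [|i _]; first exact: add_continuous.
by rewrite mxE; apply: cvgZr_tmp; exact: is_cvg_series_exp_coeff.
Qed.

Lemma expm_diag n (P Q A : 'M[R]_n) (l : 'rV[R]_n) :
  P *m Q = 1%:M -> A = P *m diag_mx l *m Q ->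
  expm A = P *m diag_mx (map_mx expR l) *m Q.
Proof. by move=> PQ AE; apply: (cvg_lim _ (cvg_expm_diag PQ AE)); exact: norm_hausdorff. Qed.

End Expm.

(** * Derivatives and numerical bounds *)

Section Deriv.
Variable R : realType.
Implicit Types f g : R -> R.

Lemma derive_mulE f g (df dg s : R) : is_derive s 1 f df -> is_derive s 1 g dg ->
  is_derive s 1 (fun s => f s * g s) (df * g s + f s * dg).
Proof.
move=> fs gs; apply: (is_derive_eq (is_deriveM fs gs)).
by rewrite addrC; congr (_ + _); exact: mulrC.
Qed.

Lemma derive_addE f g (df dg s : R) : is_derive s 1 f df -> is_derive s 1 g dg ->
  is_derive s 1 (fun s => f s + g s) (df + dg).
Proof. by move=> fs gs; exact: is_deriveD. Qed.

Lemma derive_oppE f (df s : R) : is_derive s 1 f df ->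
  is_derive s 1 (fun s => - f s) (- df).
Proof. by move=> fs; exact: is_deriveN. Qed.

Lemma derive_compE f g (df dg s : R) : is_derive (g s) 1 f df -> is_derive s 1 g dg ->
  is_derive s 1 (fun s => f (g s)) (df * dg).
Proof. by move=> fs gs; exact: (is_derive1_comp fs gs). Qed.

Lemma derive_expE f (df s : R) : is_derive s 1 f df ->
  is_derive s 1 (fun s => expR (f s)) (df * expR (f s)).
Proof. by move=> fs; rewrite mulrC; exact: (is_derive1_comp (is_derive_expR (f s)) fs). Qed.

Lemma derive_sumE n (f : 'I_n -> R -> R) (df : 'I_n -> R) (s : R) :
  (forall i, is_derive s 1 (f i) (df i)) ->
  is_derive s 1 (fun s => \sum_i f i s) (\sum_i df i).
Proof.
move=> fs; have := is_derive_sum fs.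
by rewrite (_ : (\sum_i f i) = fun s => \sum_i f i s) //; apply/funext => u; rewrite fct_sumE.
Qed.

Lemma derive_le0_nincr f (df : R -> R) (p q : R) : p <= q ->
  (forall s : R, is_derive s 1 f (df s)) ->
  (forall s, p <= s <= q -> df s <= 0) -> f q <= f p.
Proof.
move=> pq fs df0; move: pq; rewrite le_eqVlt => /predU1P[->//|pq].
have [|c cpq e] := MVT pq (fun s _ => fs s).
  by apply: derivable_within_continuous => s _; exact: ex_derive.
rewrite -subr_le0 e mulr_le0_ge0 ?subr_ge0 ?(ltW pq) //.
by apply: df0; move: cpq; rewrite in_itv /= => /andP[/ltW -> /ltW ->].
Qed.

End Deriv.

Section Scalars.
Variable R : realType.

Lemma mulrN_expR_le (x : R) : x * expR (- x) <= expR (- 1).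
Proof.
have := expR_ge1Dx (x - 1); rewrite addrC subrK => h.
have := ler_wpM2r (expR_ge0 (- x)) h; rewrite -expRD => /le_trans; apply.
by rewrite addrAC subrr add0r.
Qed.

Lemma mulr_expRM_le (x t : R) : 0 < t -> x * expR (- (x * t)) <= expR (- 1) / t.
Proof.
by move=> t0; rewrite ler_pdivlMr // mulrAC mulrN_expR_le.
Qed.

(** This is the square of the previous bound at time [t / 2]; [4 / e^2] is the maximum of
    [u^2 exp(-u)]. *)
Lemma sqr_expRM_le (x t : R) : 0 <= x -> 0 < t ->
  x ^+ 2 * expR (- (x * t)) <= 4 * expR (- 1) ^+ 2 / t ^+ 2.
Proof.
move=> x0 t0.
have -> : expR (- (x * t)) = expR (- (x * (t / 2))) ^+ 2.
  by rewrite expr2 -expRD; congr expR; field.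
rewrite -exprMn (_ : 4 * _ / _ = (expR (- 1) / (t / 2)) ^+ 2); last first.
  by field; rewrite ?gt_eqF.
have t2 : 0 < t / 2 by rewrite divr_gt0.
apply: lerXn2r; last exact: mulr_expRM_le.
  by rewrite nnegrE mulr_ge0 // expR_ge0.
by rewrite nnegrE divr_ge0 ?expR_ge0 // ltW.
Qed.

(** The first five terms of the series give [e >= 65/24], and [24/65 < 37/100]. *)
Lemma expRN1_le : expR (- 1) <= 37 / 100 :> R.
Proof.
have : 1 + 1 + 1 / 2 + 1 / 6 + 1 / 24 <= expR 1 :> R.
  rewrite /expR; apply: limr_ge; first exact: is_cvg_series_exp_coeff.
  near=> N; have : (5 <= N)%N by near: N; exact: nbhs_infty_ge.
  move=> N5; rewrite /series /= (big_cat_nat (leq0n 5) N5) /=.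
  apply: (le_trans (y := \sum_(0 <= k < 5) exp_coeff (1 : R) k)).
    rewrite !big_nat_recr //= big_nil /exp_coeff /= !expr1n !factS fact0.
    by rewrite !muln1; lra.
  by rewrite lerDl sumr_ge0 // => k _; rewrite /exp_coeff /= expr1n divr_ge0.
move=> e1; rewrite expRN -[leRHS]invrK lef_pV2 ?posrE ?expR_gt0 ?invr_gt0; lra.
Unshelve. all: by end_near. Qed.

Lemma cos_lt0_16 : cos (8 / 5) < 0 :> R.
Proof.
(* Taylor bounds on [0, +oo[, by integrating [cos <= 1] four times *)
have mono (f df : R -> R) : (forall s : R, is_derive s 1 f (df s)) ->
    (forall s, 0 <= s -> df s <= 0) -> forall s, 0 <= s -> f s <= f 0.
  move=> fs df0 s s0; apply: (derive_le0_nincr s0 fs) => u /andP[u0 _].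
  exact: df0.
have dsin (s : R) : is_derive s 1 (@sin R) (cos s) by exact: is_derive_sin.
have dcos (s : R) : is_derive s 1 (@cos R) (- sin s) by exact: is_derive_cos.
have did (s : R) : is_derive s 1 id (1 : R) by exact: is_derive_id.
have dX (s : R) k : is_derive s 1 (fun u : R => u ^+ k.+1) (k.+1%:R * s ^+ k).
  elim: k => [|k IHk]; first by apply: (is_derive_eq (did s)); rewrite expr0 mulr1.
  apply: (is_derive_eq (derive_mulE (did s) IHk)).
  by rewrite mul1r mulrCA -exprS -[k.+2%:R]natr1 mulrDl mul1r addrC.
have dZ (s : R) (c : R) (f : R -> R) (df : R) : is_derive s 1 f df ->
    is_derive s 1 (fun u => c * f u) (c * df).
  by move=> h; have := is_deriveZ c h.
have sin_le (s : R) : 0 <= s -> sin s <= s.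
  move=> s0; have := mono (fun u => sin u - u) (fun u => cos u - 1) _ _ s s0.
  rewrite sin0 subr0 subr_le0; apply.
  by move=> u _; rewrite subr_le0 cos_le1.
have cos_ge (s : R) : 0 <= s -> 1 - s ^+ 2 / 2 <= cos s.
  move=> s0; have := mono (fun u => - cos u + - (2^-1 * u ^+ 2))
    (fun u => - - sin u - 2^-1 * (2 * u ^+ 1)) _ _ s s0.
  rewrite cos0 expr0n /= mulr0 oppr0 addr0 => h.
  suff : - cos s - 2^-1 * s ^+ 2 <= -1 by lra.
  apply: h => u u0; by have := sin_le u u0; rewrite expr1; lra.
have sin_ge (s : R) : 0 <= s -> s - s ^+ 3 / 6 <= sin s.
  move=> s0; have := mono (fun u => (u + - (6^-1 * u ^+ 3)) + - sin u)
    (fun u => (1 - 6^-1 * (3 * u ^+ 2)) - cos u) _ _ s s0.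
  rewrite sin0 expr0n /= mulr0 oppr0 !addr0 => h.
  suff : s + - (6^-1 * s ^+ 3) + - sin s <= 0 by lra.
  apply: h => u u0; by have := cos_ge u u0; lra.
have cos_le (s : R) : 0 <= s -> cos s <= 1 - s ^+ 2 / 2 + s ^+ 4 / 24.
  move=> s0; have := mono (fun u => (cos u + (2^-1 * u ^+ 2)) + - (24^-1 * u ^+ 4))
    (fun u => (- sin u + 2^-1 * (2 * u ^+ 1)) - 24^-1 * (4 * u ^+ 3)) _ _ s s0.
  rewrite cos0 !expr0n /= !mulr0 oppr0 !addr0 => h.
  suff : cos s + 2^-1 * s ^+ 2 - 24^-1 * s ^+ 4 <= 1 by lra.
  apply: h => u u0; by have := sin_ge u u0; rewrite expr1; lra.
(* The quartic Taylor polynomial is about -0.007 at [8 / 5], just enough to place [pi / 2] below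
   it. *)
have := cos_le (8 / 5) _; lra.
Qed.

Lemma pi_le_16_5 : pi <= 16 / 5 :> R.
Proof.
rewrite leNgt; apply/negP => h.
have := @cos_gt0_pihalf R (8 / 5); have := cos_lt0_16 => c h'.
have : 0 < cos (8 / 5) :> R by apply: h'; lra.
lra.
Qed.

End Scalars.

(** * Operator norm bounds and semidefinite matrices *)

Section Quadratic.
Variable R : realType.

Definition sqn n (v : 'cV[R]_n) : R := (v^T *m v) 0 0.

Lemma sqnE n (v : 'cV[R]_n) : sqn v = \sum_i v i 0 ^+ 2.
Proof. exact: mulmxTE. Qed.

Lemma sqn_ge0 n (v : 'cV[R]_n) : 0 <= sqn v.
Proof. by rewrite sqnE sumr_ge0 // => i _; exact: sqr_ge0. Qed.

Lemma sqn_mulmx m n (A : 'M[R]_(m, n)) (v : 'cV[R]_n) :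
  sqn (A *m v) = (v^T *m (A^T *m A) *m v) 0 0.
Proof. by rewrite /sqn trmx_mul !mulmxA. Qed.

Lemma quadE m n (u : 'cV[R]_m) (A : 'M[R]_(m, n)) (v : 'cV[R]_n) :
  (u^T *m A *m v) 0 0 = \sum_i u i 0 * (A *m v) i 0.
Proof. by rewrite -mulmxA mxE; apply: eq_bigr => i _; rewrite mxE. Qed.

Definition norm_le m n (A : 'M[R]_(m, n)) (a : R) :=
  0 <= a /\ forall v : 'cV[R]_n, sqn (A *m v) <= a ^+ 2 * sqn v.

Lemma norm_leM m n p (A : 'M[R]_(m, n)) (B : 'M[R]_(n, p)) a b :
  norm_le A a -> norm_le B b -> norm_le (A *m B) (a * b).
Proof.
move=> [a0 Aa] [b0 Bb]; split; first exact: mulr_ge0.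
move=> v; rewrite -mulmxA; apply: (le_trans (Aa _)).
by rewrite exprMn -[leRHS]mulrA; apply: ler_wpM2l (Bb v); exact: sqr_ge0.
Qed.

Lemma norm_le_orthogonal n (U : 'M[R]_n) : U^T *m U = 1%:M -> norm_le U 1.
Proof.
move=> UU; split=> // v; rewrite /sqn trmx_mul -mulmxA (mulmxA U^T) UU mul1mx.
by rewrite expr1n mul1r.
Qed.

Lemma norm_le_diag n (f : 'I_n -> R) a : 0 <= a ->
  (forall i, `|f i| <= a) -> norm_le (diag_mx (\row_i f i)) a.
Proof.
move=> a0 fa; split=> // v; rewrite !sqnE mulr_sumr ler_sum // => i _.
rewrite mul_diag_mx !mxE exprMn ler_wpM2r ?sqr_ge0 //.
by rewrite -[leLHS]real_normK ?num_real // lerXn2r ?nnegrE.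
Qed.

(** Expand [0 <= |a u - A v|^2] and divide by [a]; if [a = 0] then [A v = 0]. *)
Lemma quad_le_sqn m n (A : 'M[R]_(m, n)) a (u : 'cV[R]_m) (v : 'cV[R]_n) : norm_le A a ->
  2 * (u^T *m A *m v) 0 0 <= a * (sqn u + sqn v).
Proof.
move=> [a0 Aa]; move: a0; rewrite le_eqVlt => /predU1P[a0|a0].
  have /eqP : sqn (A *m v) == 0.
    by rewrite eq_le sqn_ge0 andbT (le_trans (Aa v)) // -a0 expr0n mul0r.
  by move/eqP; rewrite mulmxT_eq0 => /eqP Av; rewrite -mulmxA Av mulmx0 mxE mulr0 -a0 mul0r.
have h : 0 <= sqn (a *: u - A *m v) by exact: sqn_ge0.
have e : sqn (a *: u - A *m v) = a ^+ 2 * sqn u - 2 * a * (u^T *m A *m v) 0 0 + sqn (A *m v).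
  rewrite !sqnE quadE !mulr_sumr -!sumrN -!big_split /=; apply: eq_bigr => i _.
  by rewrite !mxE; ring.
have hv := Aa v; rewrite e in h; rewrite -(ler_pM2l a0).
move: (sqn u) (sqn v) (sqn (A *m v)) (_ 0 0) h hv => p q r z h hv; lra.
Qed.

(** Expanding [0 <= |a^2 v - A A^T v|^2] and bounding [|A A^T v|^2] by [a^2 |A^T v|^2] gives the
    claim without square roots. *)
Lemma norm_le_tr m n (A : 'M[R]_(m, n)) a : norm_le A a -> norm_le A^T a.
Proof.
move=> Aa; split=> [|v]; first by case: Aa.
have e : (v^T *m A *m (A^T *m v)) 0 0 = sqn (A^T *m v).
  by rewrite /sqn trmx_mul trmxK.
case: (Aa) => a0 h; have := h (A^T *m v).
move=> h2.
have h1 := sqn_ge0 (a ^+ 2 *: v - A *m (A^T *m v)).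
have h1' : sqn (a ^+ 2 *: v - A *m (A^T *m v)) =
    a ^+ 2 * (a ^+ 2 * sqn v - 2 * sqn (A^T *m v)) + sqn (A *m (A^T *m v)).
  rewrite -e quadE !sqnE mulrBr !mulr_sumr -!sumrN -!big_split /=; apply: eq_bigr => i _.
  by rewrite !mxE; ring.
have [a00|a_gt0] := eqVneq a 0.
  have : sqn (A *m (A^T *m v)) = 0.
    by apply/eqP; rewrite eq_le sqn_ge0 andbT (le_trans h2) // a00 expr0n mul0r.
  move/eqP; rewrite mulmxT_eq0 => /eqP z.
  by rewrite -e -mulmxA z mulmx0 mxE mulr_ge0 ?sqr_ge0 ?sqn_ge0.
have a2 : 0 < a ^+ 2 by rewrite exprn_gt0 // lt_neqAle eq_sym a_gt0.
rewrite h1' in h1; rewrite -(ler_pM2l a2).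
move: (sqn v) (sqn (A^T *m v)) (sqn _) h1 h2 => p q r h1 h2; lra.
Qed.

Definition psd n (N : 'M[R]_n) :=
  N^T = N /\ forall v : 'cV[R]_n, 0 <= (v^T *m N *m v) 0 0.

Lemma mxtrace_quad m n (A : 'M[R]_n) (X : 'M[R]_(m, n)) :
  \tr (X *m A *m X^T) = \sum_i ((row i X)^T^T *m A *m (row i X)^T) 0 0.
Proof.
apply: eq_bigr => i _; rewrite trmxK -row_mul mxE [RHS]mxE.
by apply: eq_bigr => k _; rewrite !mxE.
Qed.

Lemma mxtrace_quad_le m n (A B : 'M[R]_n) (X : 'M[R]_(m, n)) :
  (forall v : 'cV[R]_n, (v^T *m A *m v) 0 0 <= (v^T *m B *m v) 0 0) ->
  \tr (X *m A *m X^T) <= \tr (X *m B *m X^T).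
Proof. by move=> AB; rewrite !mxtrace_quad ler_sum. Qed.

(** The difference of the two sides is the trace of [(X - Y^T) N (X - Y^T)^T]. *)
Lemma psd_cauchy_schwarz m n (N : 'M[R]_n) (X : 'M[R]_(m, n)) (Y : 'M[R]_(n, m)) :
  psd N -> 2 * \tr (X *m N *m Y) <= \tr (X *m N *m X^T) + \tr (Y^T *m N *m Y).
Proof.
move=> [NT N0]; rewrite -subr_ge0.
suff -> : \tr (X *m N *m X^T) + \tr (Y^T *m N *m Y) - 2 * \tr (X *m N *m Y) =
    \tr ((X - Y^T) *m N *m (X - Y^T)^T).
  by rewrite mxtrace_quad sumr_ge0.
rewrite [(X - Y^T)^T]linearB /= trmxK mulmxBl mulmxBr mulmxBl mulmxBl.
rewrite !raddfB /= (_ : \tr (Y^T *m N *m X^T) = \tr (X *m N *m Y)); first by ring.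
by rewrite -[LHS]mxtrace_tr !trmx_mul !trmxK NT mulmxA.
Qed.

Lemma psd_eigenvalue_ge0 n (W : 'M[R]_n) (l : 'rV[R]_n) i : W *m W^T = 1%:M ->
  psd (W^T *m diag_mx l *m W) -> 0 <= l 0 i.
Proof.
move=> WW [_ /(_ (W^T *m delta_mx i 0))]; rewrite trmx_mul trmxK !mulmxA.
rewrite -(mulmxA _ W) WW mulmx1 -(mulmxA _ W) WW mulmx1.
by rewrite trmx_delta -rowE -colE !mxE eqxx mulr1n.
Qed.

Lemma psd_diag_ge0 n (N : 'M[R]_n) i : psd N -> 0 <= N i i.
Proof. by move=> [_ /(_ (delta_mx i 0))]; rewrite trmx_delta -rowE -colE !mxE. Qed.

Lemma psd_mxtrace_ge0 n (N : 'M[R]_n) : psd N -> 0 <= \tr N.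
Proof. by move=> Npsd; apply: sumr_ge0 => i _; exact: psd_diag_ge0. Qed.

(** Trace duality: in an eigenbasis of [N] the trace is a sum of diagonal entries of [A], each at
    most [a], with the nonnegative eigenvalues as weights. *)
Lemma mxtrace_psd_le n (N A : 'M[R]_n) a : psd N -> norm_le A a ->
  \tr (A *m N) <= a * \tr N.
Proof.
move=> [NT N0] Aa; have [W WW [l NE]] := symmetric_diagonalization NT.
have WW' : W *m W^T = 1%:M by exact: mulmx1C.
have l0 i : 0 <= l 0 i by apply: (psd_eigenvalue_ge0 i WW'); rewrite -NE.
rewrite NE !mulmxA mxtrace_mulC !mulmxA.
rewrite [X in _ <= _ * X]mxtrace_mulC mulmxA WW' mul1mx mxtrace_diag mulr_sumr.
apply: ler_sum => i _; rewrite mul_mx_diag mxE mulrC [leRHS]mulrC ler_wpM2l //.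
pose u : 'cV[R]_n := W^T *m delta_mx i 0.
have u1 : sqn u = 1.
  rewrite /sqn trmx_mul trmxK mulmxA -(mulmxA _ W) WW' mulmx1 trmx_delta mul_delta_mx.
  by rewrite mxE.
have := quad_le_sqn u u Aa.
have -> : u^T *m A *m u = delta_mx 0 i *m (W *m A *m W^T) *m delta_mx i 0.
  by rewrite /u trmx_mul trmxK trmx_delta !mulmxA.
move: (W *m A *m W^T) => M; rewrite u1 -rowE -colE !mxE.
by rewrite mulr2n mulrDr mulr1; lra.
Qed.

End Quadratic.

(** * Compressed semigroups in eigencoordinates *)

Section Core.
Variables (R : realType) (n m : nat).
Variables (x : 'I_n -> R) (y : 'I_m -> R) (C G : 'M[R]_(n, m)) (D0 U : 'M[R]_n).
Variable N : 'M[R]_m.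
Variable e : R.
Local Notation dg f := (diag_mx (\row_i f i)).
Hypothesis NE : N = 1%:M - C^T *m C.
Hypothesis x_ge0 : forall i, 0 <= x i.
Hypothesis y_ge0 : forall j, 0 <= y j.
Hypothesis LC : dg x *m C = G *m dg y.
Hypothesis LD0 : dg x *m D0 = 1%:M - G *m C^T.
Hypothesis CLC : C^T *m dg x *m C = dg y.
Hypothesis Npsd : psd N.
Hypothesis N_le : forall v : 'cV[R]_m, (v^T *m N *m v) 0 0 <= e * (v^T *m dg y *m v) 0 0.
Hypothesis D0psd : psd D0.
Hypothesis trD0 : \tr D0 = e.
Hypothesis UU : U^T *m U = 1%:M.

(** The section works in orthonormal eigenbases with time rescaled to [[0, 1]]: [x] and [y] stand
    for the eigenvalues of [t L] and [t Lhat]. [K] and [H] are the two parts of the intertwining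
    defect; [W] absorbs the test matrix and the final [C^T]. *)
Let K := D0 *m C.
Let H := G *m N.
Let W := C^T *m U.
Let Z i := (D0 *m U) i i.
Let kp : R := expR (- 1).

Let pS (f : 'I_n -> 'I_m -> R) := \sum_i \sum_j f i j * W j i.

Let ex (a s : R) := expR (- (a * s)).

Lemma error_ge0 : 0 <= e.
Proof.
by rewrite -trD0 psd_mxtrace_ge0.
Qed.

Lemma extension_norm_le : norm_le C 1.
Proof.
split=> // v; have [_ /(_ v)] := Npsd.
rewrite NE mulmxBr mulmxBl mulmx1 [X in 0 <= X]mxE [X in _ + X]mxE subr_ge0 expr1n mul1r.
by rewrite /sqn trmx_mul !mulmxA.
Qed.

Lemma pairing_trace a b (M : 'M[R]_(n, m)) :
  pS (fun i j => a i * b j * M i j) = \tr (U *m (dg a *m M *m dg b) *m C^T).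
Proof.
rewrite /pS -(mulmxA U) mxtrace_mulC -(mulmxA _ C^T U) -/W; move: (W) => W'.
apply: eq_bigr => i _; rewrite mxE.
by apply: eq_bigr => j _; rewrite mul_mx_diag mul_diag_mx !mxE; ring.
Qed.

Lemma diag_pairing_trace a : \sum_i a i * Z i = \tr (U *m (dg a *m D0)).
Proof.
rewrite mxtrace_mulC -mulmxA /Z; move: (D0 *m U) => M; apply: eq_bigr => i _.
by rewrite mul_diag_mx !mxE.
Qed.

(** [LC] replaces [x C] by [G y], and [LD0] applied to [C] gives [x K = C - G + H]; eliminate
    [G]. *)
Lemma intertwining_defect i j : (y j - x i) * C i j = x i * y j * K i j - y j * H i j.
Proof.
have e1 : x i * C i j = G i j * y j.
  by have /matrixP/(_ i j) := LC; rewrite mul_diag_mx mul_mx_diag !mxE.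
have e2 : x i * K i j = C i j - G i j + H i j.
  have : dg x *m K = C - G + H.
    rewrite /K mulmxA LD0 mulmxBl mul1mx /H NE mulmxBr mulmx1 -!mulmxA.
    by rewrite addrA subrK.
  by move/matrixP/(_ i j); rewrite mul_diag_mx; move: (K) (H) => K' H'; rewrite !mxE.
transitivity (y j * (C i j - G i j + H i j) - y j * H i j); last by rewrite -e2; ring.
by rewrite mulrBl e1; ring.
Qed.

(** Cyclicity brings [D0] to the end of the trace. The remaining factor [C b C^T U a] has operator
    norm at most [al * be], since [C] is a contraction. *)
Lemma pairing_le a b (al be : R) : 0 <= al -> 0 <= be ->
  (forall i, `|a i| <= al) -> (forall j, `|b j| <= be) ->
  pS (fun i j => a i * b j * K i j) <= al * be * e.
Proof.
move=> al0 be0 ha hb; rewrite pairing_trace /K.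
have -> : \tr (U *m (dg a *m (D0 *m C) *m dg b) *m C^T) =
    \tr ((C *m dg b *m C^T *m U *m dg a) *m D0).
  by rewrite -!mulmxA mxtrace_mulC -!mulmxA mxtrace_mulC -!mulmxA mxtrace_mulC -!mulmxA.
rewrite -trD0; apply: mxtrace_psd_le => //.
have -> : al * be = 1 * be * 1 * 1 * al by rewrite !mulr1 mul1r mulrC.
by do 4?[apply: norm_leM]; [exact: extension_norm_le|exact: norm_le_diag|
  exact: norm_le_tr extension_norm_le|exact: norm_le_orthogonal|exact: norm_le_diag].
Qed.

(** [M = C b C^T] has its spectrum in [[0, 1]]: in [|(M - 1/2) v|^2 = |M v|^2 - v^T M v + |v|^2 / 4]
    the first two terms sum to a nonpositive number. *)
Lemma half_shift_norm_le b : (forall j, 0 <= b j <= 1) ->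
  norm_le (C *m dg b *m C^T - (1 / 2)%:M) (1 / 2).
Proof.
move=> b01; split=> [|v]; first by rewrite divr_ge0.
pose w := C^T *m v; have [_ hC] := extension_norm_le.
have -> : sqn ((C *m dg b *m C^T - (1 / 2)%:M) *m v) =
    sqn (C *m (dg b *m w)) - (w^T *m dg b *m w) 0 0 + (1 / 2) ^+ 2 * sqn v.
  have -> : (w^T *m dg b *m w) 0 0 = (v^T *m C *m (dg b *m w)) 0 0.
    by rewrite /w trmx_mul trmxK !mulmxA.
  rewrite quadE mulmxBl -!mulmxA -/w mul_scalar_mx !sqnE mulr_sumr -sumrN -!big_split /=.
  by apply: eq_bigr => i _; move: (C *m _) => M; rewrite !mxE; field.
rewrite gerDr subr_le0 (le_trans (hC _)) // expr1n mul1r sqnE quadE.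
move: (w) => u; apply: ler_sum => j _; rewrite mul_diag_mx !mxE.
have /andP[b0 b1] := b01 j.
rewrite (_ : u j 0 * _ = b j * u j 0 ^+ 2); last by ring.
by rewrite exprMn ler_wpM2r ?sqr_ge0 // expr2 ler_piMr.
Qed.

Lemma shifted_pairing_le a b (al : R) : 0 <= al -> (forall i, `|a i| <= al) ->
  (forall j, 0 <= b j <= 1) ->
  pS (fun i j => a i * b j * K i j) - 1 / 2 * \sum_i a i * Z i <= al / 2 * e.
Proof.
move=> al0 ha hb; rewrite pairing_trace diag_pairing_trace -trD0 /K.
have -> : \tr (U *m (dg a *m (D0 *m C) *m dg b) *m C^T) - 1 / 2 * \tr (U *m (dg a *m D0)) =
    \tr (((C *m dg b *m C^T - (1 / 2)%:M) *m (U *m dg a)) *m D0).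
  rewrite mulmxBl mulmxBl raddfB /=; congr (_ - _).
    by rewrite -!mulmxA mxtrace_mulC -!mulmxA mxtrace_mulC -!mulmxA mxtrace_mulC -!mulmxA.
  by rewrite mul_scalar_mx -scalemxAl mxtraceZ mulmxA.
apply: mxtrace_psd_le => //.
have -> : al / 2 = 1 / 2 * (1 * al) by rewrite !mul1r mulrC.
apply: norm_leM; first exact: half_shift_norm_le.
by apply: norm_leM; [exact: norm_le_orthogonal|exact: norm_le_diag].
Qed.

Lemma diag_pairing_le a (al : R) : 0 <= al -> (forall i, `|a i| <= al) ->
  \sum_i a i * Z i <= al * e.
Proof.
move=> al0 ha; rewrite diag_pairing_trace -trD0 mulmxA.
apply: mxtrace_psd_le => //; rewrite -[al]mul1r.
by apply: norm_leM; [exact: norm_le_orthogonal|exact: norm_le_diag].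
Qed.

Lemma defect_row0 j k : y j = 0 -> N j k = 0.
Proof.
move=> yj0; have [NT N0] := Npsd.
have Njj : N j j <= 0.
  have := N_le (delta_mx j 0); rewrite trmx_delta -!rowE -!colE.
  by rewrite !mxE eqxx mulr1n yj0 mulr0.
apply/eqP/negP => /negP Njk.
(* A semidefinite matrix with a nonpositive diagonal entry has a zero row there: this [c] would
   bring the form at [c e_j + e_k] down to at most -1. *)
pose c := - (N k k + 1) / (2 * N j k).
have := N0 (c *: delta_mx j 0 + delta_mx k 0).
rewrite [(_ + _)^T]linearD /= [(_ *: _)^T]linearZ /= !trmx_delta !mulmxDl !mulmxDr -!scalemxAl -!scalemxAr.
rewrite -!rowE -!colE.
have Nkj : N k j = N j k by rewrite -{1}NT mxE.
rewrite !mxE Nkj.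
have -> : c * (c * N j j) + c * N j k + (c * N j k + N k k) =
   c ^+ 2 * N j j - 1 by rewrite /c; field.
have := mulr_ge0_le0 (sqr_ge0 c) Njj; lra.
Qed.

(* The inverse of [y j] is [0] when [y j = 0], which drops the null space
   of the compressed operator. *)
Let xi i := \sum_j x i * C i j ^+ 2 / y j.

(** By [CLC] the column sums [\sum_i x i * C i j ^+ 2] are the [y j], so every nonzero [y j]
    contributes 1. This is the rank count behind [|I| - 1]. *)
Lemma sum_xi : \sum_i xi i = #|[pred j | y j != 0]|%:R.
Proof.
rewrite exchange_big /= -sum1_card natr_sum [RHS]big_mkcond /=; apply: eq_bigr => j _.
have /matrixP/(_ j j) := CLC; rewrite !mxE eqxx mulr1n => yE.
rewrite -mulr_suml (_ : \sum_i _ = y j).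
  by rewrite inE; case: eqVneq => [->|y0]; [rewrite invr0 mulr0|rewrite divff].
rewrite -yE; apply: eq_bigr => i _.
by rewrite mul_mx_diag !mxE; ring.
Qed.

(** [LC] recovers [G] as [x C / y] in the columns where [y] is nonzero; the other columns meet zero
    rows of [N]. *)
Lemma defect_productE : H = (\matrix_(i, j) (x i * C i j / y j)) *m N.
Proof.
apply/matrixP => i k; rewrite !mxE; apply: eq_bigr => j _; rewrite !mxE.
have [y0|y0] := eqVneq (y j) 0; first by rewrite defect_row0 // !mulr0.
congr (_ * _); have /matrixP/(_ i j) := LC.
by rewrite mul_diag_mx mul_mx_diag !mxE => ->; field.
Qed.

(** Cauchy-Schwarz for the form [N] separates the two sides, and [N <= e Lhat] bounds each. On the
    left, one factor [y] cancels one of the two inverses in [(x C / y)^2], which leaves [xi]; on the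
    right, [U] drops out by orthogonality. *)
Lemma defect_pairing_le a b :
  2 * pS (fun i j => a i * b j * H i j) <=
    e * (\sum_i xi i * (x i * a i ^+ 2) + \sum_j y j * b j ^+ 2).
Proof.
rewrite pairing_trace defect_productE; set X0 := \matrix_(i, j) (x i * C i j / y j).
have -> : \tr (U *m (dg a *m (X0 *m N) *m dg b) *m C^T) =
    \tr ((dg a *m X0) *m N *m (dg b *m C^T *m U)).
  by rewrite -!mulmxA mxtrace_mulC -!mulmxA.
apply: (le_trans (psd_cauchy_schwarz _ _ Npsd)).
have N_le' (v : 'cV[R]_m) : (v^T *m N *m v) 0 0 <= (v^T *m (e *: dg y) *m v) 0 0.
  by rewrite -scalemxAr -scalemxAl [leRHS]mxE.
have hX := mxtrace_quad_le (dg a *m X0) N_le'.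
have hY := mxtrace_quad_le (dg b *m C^T *m U)^T N_le'; rewrite trmxK in hY.
apply: (le_trans (lerD hX hY)).
rewrite -!scalemxAr -!scalemxAl !mxtraceZ -mulrDr ler_wpM2l ?error_ge0 // lerD //.
  apply: ler_sum => i _; rewrite mxE le_eqVlt; apply/orP; left; apply/eqP.
  rewrite /xi mulr_suml; apply: eq_bigr => j _.
  rewrite mul_mx_diag mul_diag_mx !mxE.
  by have [->|y0] := eqVneq (y j) 0; [rewrite invr0; ring|field].
have -> : \tr ((dg b *m C^T *m U)^T *m dg y *m (dg b *m C^T *m U)) =
    \tr (dg (fun j => y j * b j ^+ 2) *m (C^T *m C)).
  rewrite !trmx_mul trmxK tr_diag_mx !mulmxA mxtrace_mulC !mulmxA (mulmx1C UU) mul1mx.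
  have <- : dg b *m (dg y *m dg b) = dg (fun j => y j * b j ^+ 2).
    apply/matrixP => i j; rewrite !mul_diag_mx !mxE.
    by case: eqP => [->|_]; rewrite ?mulr1n ?mulr0n; ring.
  by rewrite mxtrace_mulC [RHS]mxtrace_mulC -!mulmxA [LHS]mxtrace_mulC -!mulmxA.
(* The diagonal of [C^T C] is at most 1, because that of [N] is nonnegative. *)
apply: ler_sum => j _; rewrite mul_diag_mx.
have := psd_diag_ge0 j Npsd.
rewrite NE; move: (C^T *m C) => M; rewrite !mxE eqxx subr_ge0 => Mj.
by rewrite ler_piMr // mulr_ge0 ?sqr_ge0.
Qed.


(** * Exponential weights and the derivative of the interpolation *)

Lemma decay_ge0 a s : 0 <= ex a s. Proof. exact: expR_ge0. Qed.

Lemma decay_le1 a s : 0 <= a -> 0 <= s -> ex a s <= 1.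
Proof. by move=> a0 s0; rewrite /ex -expR0 ler_expR oppr_le0 mulr_ge0. Qed.

Lemma decay0 a : ex a 0 = 1.
Proof. by rewrite /ex mulr0 oppr0 expR0. Qed.

Lemma mul_decay_le a s : 0 <= a -> 0 < s -> `|a * ex a s| <= kp / s.
Proof.
by move=> a0 s0; rewrite ger0_norm ?mulr_ge0 ?decay_ge0 // mulr_expRM_le.
Qed.

Lemma sqr_mul_decay_le a s : 0 <= a -> 0 < s -> `|a * (a * ex a s)| <= 4 * kp ^+ 2 / s ^+ 2.
Proof.
move=> a0 s0; rewrite ger0_norm ?mulr_ge0 ?decay_ge0 //.
by rewrite mulrA -expr2 sqr_expRM_le.
Qed.

Lemma inv_sqr_le (s : R) : 4 / 5 <= s -> 4 * kp ^+ 2 / s ^+ 2 <= 25 / 4 * kp ^+ 2.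
Proof.
move=> s45; have -> : 25 / 4 * kp ^+ 2 = 4 * kp ^+ 2 / (4 / 5) ^+ 2 by field.
have s0 : 0 < s by lra.
apply: ler_wpM2l; first by rewrite mulr_ge0 // sqr_ge0.
rewrite lef_pV2 ?posrE ?exprn_gt0 ?divr_gt0 //.
by apply: lerXn2r; rewrite ?nnegrE ?divr_ge0 // ltW.
Qed.

Lemma half_sub_decay_le a s : 0 <= a -> 0 <= s -> `|1 / 2 - ex a s| <= 1 / 2.
Proof.
move=> a0 s0; have h0 := decay_ge0 a s; have h1 := decay_le1 a0 s0.
by rewrite ler_norml; apply/andP; split; lra.
Qed.

Lemma decay_deriv a (s : R) : is_derive s 1 (fun s => ex a s) (- a * ex a s).
Proof.
apply: derive_expE; apply: derive_oppE.
have := is_deriveZ a (is_derive_id s (1 : R)).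
by move=> h; apply: (is_derive_eq h); rewrite /GRing.scale /= mulr1.
Qed.

Lemma onem_deriv (s : R) : is_derive s 1 (fun s => 1 - s) (-1).
Proof.
apply: (is_derive_eq (derive_addE (is_derive_cst (1 : R) s 1) (derive_oppE (is_derive_id s (1 : R))))).
by rewrite add0r.
Qed.

Lemma decay_onem_deriv a (s : R) : is_derive s 1 (fun s => ex a (1 - s)) (a * ex a (1 - s)).
Proof.
apply: (is_derive_eq (@derive_compE _ _ (fun s => 1 - s) _ _ _ (decay_deriv a (1 - s)) (onem_deriv s))).
by ring.
Qed.

Lemma pairing_deriv (f : 'I_n -> 'I_m -> R -> R) df (s : R) :
  (forall i j, is_derive s 1 (f i j) (df i j)) ->
  is_derive s 1 (fun s => pS (fun i j => f i j s)) (pS df).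
Proof.
move=> fs; apply: derive_sumE => i; apply: derive_sumE => j.
apply: (is_derive_eq (derive_mulE (fs i j) (is_derive_cst (W j i) s 1))).
by rewrite mulr0 addr0.
Qed.

Lemma eq_pairing f g : (forall i j, f i j = g i j) -> pS f = pS g.
Proof. by move=> fg; apply: eq_bigr => i _; apply: eq_bigr => j _; rewrite fg. Qed.

Lemma pairingD f g : pS f + pS g = pS (fun i j => f i j + g i j).
Proof.
rewrite /pS -big_split /=; apply: eq_bigr => i _.
by rewrite -big_split /=; apply: eq_bigr => j _; rewrite mulrDl.
Qed.

Lemma pairingN f : - pS f = pS (fun i j => - f i j).
Proof.
by rewrite /pS -sumrN; apply: eq_bigr => i _; rewrite -sumrN; apply: eq_bigr => j _; rewrite mulNr.
Qed.

(* The increment of [P] over [0, 1] is the traced error, up to a boundary term.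
   The summand [s * H] is there to make the factor of [H] in [dP] equal to
   [(1 - x s)(1 - y (1 - s)) - x s * y (1 - s)], in which every factor, times
   its exponential, is square integrable in [s] uniformly in [x] and [y]. *)
Let P s := pS (fun i j => ex (x i) s * ex (y j) (1 - s) * (C i j + s * H i j)).
Let dP s := pS (fun i j => ex (x i) s * ex (y j) (1 - s) *
  (x i * y j * K i j + (1 - x i * s - y j * (1 - s)) * H i j)).
Let h s := pS (fun i j => (x i * ex (x i) s) * (y j * ex (y j) (1 - s)) * K i j).

Lemma interpolant_deriv (s : R) : is_derive s 1 P (dP s).
Proof.
apply: pairing_deriv => i j.
have d1 := derive_mulE (decay_deriv (x i) s) (decay_onem_deriv (y j) s).
have d2 := derive_addE (is_derive_cst (C i j) s (1 : R))
  (derive_mulE (is_derive_id s (1 : R)) (is_derive_cst (H i j) s (1 : R))).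
apply: (is_derive_eq (derive_mulE d1 d2)).
move: (intertwining_defect i j) => rel.
rewrite (_ : x i * y j * K i j = (y j - x i) * C i j + y j * H i j); last by rewrite rel subrK.
by rewrite /=; ring.
Qed.

(** [q] adds the squares of the two weights [(1 - a s) exp(-a s)] and [a s exp(-a s)]. For [a > 0],
    [A a] is the primitive of [a * q a] that vanishes at infinity, and [A a 0 = - 1 / 2], so the
    integral over the half-line does not depend on [a]. *)
Let q (a s : R) := ex a s * ex a s * ((1 - a * s) ^+ 2 + (a * s) ^+ 2).
Let A (a s : R) := - (ex a s * ex a s * (1 / 2 + (a * s) * (a * s))).

Lemma weight_primitive_deriv a (s : R) : is_derive s 1 (A a) (a * q a s).
Proof.
have d0 : is_derive s 1 (fun s => a * s) a.
  have hh := is_deriveZ a (is_derive_id s (1 : R)).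
  by apply: (is_derive_eq hh); rewrite /GRing.scale /= mulr1.
have d1 := derive_addE (is_derive_cst (1 / 2 : R) s (1 : R)) (derive_mulE d0 d0).
have d2 := derive_mulE (decay_deriv a s) (decay_deriv a s).
apply: (is_derive_eq (derive_oppE (derive_mulE d2 d1))).
by rewrite /q /=; field.
Qed.

Let T s := \sum_i xi i * A (x i) s + - \sum_j A (y j) (1 - s).
Let dT s := \sum_i xi i * (x i * q (x i) s) + \sum_j y j * q (y j) (1 - s).

Lemma trace_primitive_deriv (s : R) : is_derive s 1 T (dT s).
Proof.
have d1 i : is_derive s 1 (fun s => xi i * A (x i) s) (xi i * (x i * q (x i) s)).
  apply: (is_derive_eq (derive_mulE (is_derive_cst (xi i) s (1 : R)) (weight_primitive_deriv (x i) s))).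
  by rewrite mul0r add0r.
have d2 j := @derive_compE _ _ (fun s => 1 - s) _ _ _ (weight_primitive_deriv (y j) (1 - s)) (onem_deriv s).
apply: (is_derive_eq (derive_addE (derive_sumE d1) (derive_oppE (derive_sumE d2)))).
by congr (_ + _); rewrite -sumrN; apply: eq_bigr => j _; ring.
Qed.

Lemma xi_ge0 i : 0 <= xi i.
Proof.
by apply: sumr_ge0 => j _; rewrite divr_ge0 // mulr_ge0 // sqr_ge0.
Qed.

Lemma weight_primitive0 a : A a 0 = - (1 / 2).
Proof. by rewrite /A decay0 mulr0; field. Qed.

Lemma weight_primitive_le0 a s : A a s <= 0.
Proof.
rewrite /A oppr_le0 mulr_ge0 ?mulr_ge0 ?decay_ge0 // addr_ge0 ?divr_ge0 //.
by rewrite -expr2 sqr_ge0.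
Qed.

(** Since [A <= 0] and [A a 0 = - 1 / 2], each increment is at most 1/2. The [x] side has total
    weight [\sum_i xi i], the number of nonzero [y j]; the [y] side has that many nonzero terms. *)
Lemma trace_primitive_diff : T 1 - T 0 <= #|[pred j | y j != 0]|%:R.
Proof.
rewrite /T subr0 subrr.
have e1 : \sum_i xi i * A (x i) 1 - \sum_i xi i * A (x i) 0 <= 1 / 2 * \sum_i xi i.
  rewrite mulr_sumr -sumrB ler_sum // => i _; rewrite weight_primitive0 -mulrBr mulrC.
  rewrite ler_wpM2r ?xi_ge0 //.
  by have := weight_primitive_le0 (x i) 1; lra.
have e2 : - \sum_j A (y j) 0 + \sum_j A (y j) 1 <= 1 / 2 * #|[pred j | y j != 0]|%:R.
  rewrite -sumrN -big_split /= -sum1_card natr_sum mulr_sumr [leRHS]big_mkcond /=.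
  (* For [y j = 0] the function [A (y j)] is constant, so its two boundary values cancel. *)
  apply: ler_sum => j _; rewrite inE weight_primitive0; case: eqVneq => [->|_] /=.
    by rewrite /A /ex !mul0r oppr0 expR0; lra.
  by have := weight_primitive_le0 (y j) 1; lra.
rewrite sum_xi in e1; lra.
Qed.

(** The coefficient of [H] is a difference of two products; [defect_pairing_le] applies to each, and
    the squares add up to [q]. *)
Lemma defect_rate_le s : dP s - h s <= e / 2 * dT s.
Proof.
have k1 := defect_pairing_le (fun i => ex (x i) s * (1 - x i * s)) (fun j => ex (y j) (1 - s) * (1 - y j * (1 - s))).
have k2 := defect_pairing_le (fun i => - (ex (x i) s * (x i * s))) (fun j => ex (y j) (1 - s) * (y j * (1 - s))).
have -> : dP s - h s = pS (fun i j => ex (x i) s * (1 - x i * s) * (ex (y j) (1 - s) * (1 - y j * (1 - s))) * H i j)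
   + pS (fun i j => - (ex (x i) s * (x i * s)) * (ex (y j) (1 - s) * (y j * (1 - s))) * H i j).
  rewrite pairingN !pairingD; apply: eq_pairing => i j; ring.
have -> : dT s = (\sum_i xi i * (x i * (ex (x i) s * (1 - x i * s)) ^+ 2) +
      \sum_j y j * (ex (y j) (1 - s) * (1 - y j * (1 - s))) ^+ 2) +
   (\sum_i xi i * (x i * (- (ex (x i) s * (x i * s))) ^+ 2) +
      \sum_j y j * (ex (y j) (1 - s) * (y j * (1 - s))) ^+ 2).
  rewrite addrACA -!big_split /=; congr (_ + _); apply: eq_bigr => i _; rewrite /q; ring.
lra.
Qed.

(* The supremum of [x * ex x s] over [x] is of order [1 / s], not integrable near
   [0]: integrate by parts, with the primitive [1 / 2 - ex x s] of smallest sup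
   norm. *)
Let G1 s := pS (fun i j => (1 / 2 - ex (x i) s) * (y j * ex (y j) (1 - s)) * K i j).
Let r1 s := pS (fun i j => (1 / 2 - ex (x i) s) * (y j * (y j * ex (y j) (1 - s))) * K i j).

Lemma left_corrector_deriv (s : R) : is_derive s 1 G1 (h s + r1 s).
Proof.
rewrite /h /r1 pairingD; apply: pairing_deriv => i j.
have d1 := derive_addE (is_derive_cst (1 / 2 : R) s (1 : R)) (derive_oppE (decay_deriv (x i) s)).
have d2 := derive_mulE (is_derive_cst (y j) s (1 : R)) (decay_onem_deriv (y j) s).
apply: (is_derive_eq (derive_mulE (derive_mulE d1 d2) (is_derive_cst (K i j) s (1 : R)))).
by rewrite /=; ring.
Qed.

(* The mirror image of [G1] near [s = 1], where the correction [- 1 / 2] has to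
   be applied on the whole space and not on the range of [C]. *)
Let G3 s := pS (fun i j => (x i * ex (x i) s) * ex (y j) (1 - s) * K i j)
  - 1 / 2 * \sum_i (x i * ex (x i) s) * Z i.
Let r3 s := pS (fun i j => (x i * (x i * ex (x i) s)) * ex (y j) (1 - s) * K i j)
  - 1 / 2 * \sum_i (x i * (x i * ex (x i) s)) * Z i.

Lemma right_corrector_deriv (s : R) : is_derive s 1 G3 (h s - r3 s).
Proof.
have d1 i := derive_mulE (is_derive_cst (x i) s (1 : R)) (decay_deriv (x i) s).
have d2 i := derive_mulE (d1 i) (is_derive_cst (Z i) s (1 : R)).
have d3 := derive_mulE (is_derive_cst (1 / 2 : R) s (1 : R)) (derive_sumE d2).
have d4 := pairing_deriv (fun i j => derive_mulE (derive_mulE (d1 i) (decay_onem_deriv (y j) s))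
  (is_derive_cst (K i j) s (1 : R))).
apply: (is_derive_eq (derive_addE d4 (derive_oppE d3))).
pose p3 := pS (fun i j => (x i * (x i * ex (x i) s)) * ex (y j) (1 - s) * K i j).
pose z3 := \sum_i (x i * (x i * ex (x i) s)) * Z i.
have -> : h s - r3 s = (h s - p3) + 1 / 2 * z3 by rewrite /r3 -/p3 -/z3; ring.
congr (_ + _).
  by rewrite /h /p3 pairingN pairingD; apply: eq_pairing => i j /=; ring.
rewrite mul0r add0r -mulrN -sumrN; congr (_ * _); apply: eq_bigr => i _ /=; ring.
Qed.

(** * Integration over [[0, 1/5]], [[1/5, 4/5]] and [[4/5, 1]] *)

Let c1 := e * (25 / 8 * kp ^+ 2).

Lemma interpolant_left_le : P (1 / 5) - e / 2 * T (1 / 5) - G1 (1 / 5) - c1 / 5 <=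
  P 0 - e / 2 * T 0 - G1 0.
Proof.
pose f s := ((P s + - (e / 2 * T s)) + - G1 s) + - (c1 * s).
have df (s : R) : is_derive s 1 f (((dP s - e / 2 * dT s) - (h s + r1 s)) - c1).
  have t1 := derive_mulE (is_derive_cst (e / 2) s (1 : R)) (trace_primitive_deriv s).
  have t2 := derive_mulE (is_derive_cst c1 s (1 : R)) (is_derive_id s (1 : R)).
  apply: (is_derive_eq (derive_addE (derive_addE (derive_addE (interpolant_deriv s) (derive_oppE t1))
    (derive_oppE (left_corrector_deriv s))) (derive_oppE t2))).
  by rewrite /=; ring.
have : f (1 / 5) <= f 0.
  apply: (derive_le0_nincr _ df) => [|s /andP[s0 s1]]; first by rewrite divr_ge0.
  have hk := defect_rate_le s.
  have hr : - r1 s <= 1 / 2 * (25 / 4 * kp ^+ 2) * e.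
    (* Here [1 - s >= 4 / 5], so the second factor is at most [4 kp^2 / (4/5)^2], and [1 / 2 - ex]
       contributes 1/2: this is [c1]. *)
    rewrite /r1 pairingN.
    rewrite (eq_pairing (g := fun i j => - (1 / 2 - ex (x i) s) * (y j * (y j * ex (y j) (1 - s))) * K i j)); last by move=> i j; ring.
    apply: pairing_le => [||i|j]; rewrite ?divr_ge0 //.
    - by rewrite mulr_ge0 ?sqr_ge0 // divr_ge0.
    - by rewrite normrN half_sub_decay_le.
    - apply: (le_trans (sqr_mul_decay_le _ _)) => //; first by lra.
      by apply: inv_sqr_le; lra.
  by rewrite /c1; lra.
by rewrite /f mulr0 subr0; lra.
Qed.

(* [1 / (s (1 - s)) <= 4 + 25 (s - 1 / 2)^2] on [1 / 5, 4 / 5], whose primitive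
   is the polynomial [g]. *)
Lemma interpolant_middle_le : P (4 / 5) - e / 2 * T (4 / 5) <=
  P (1 / 5) - e / 2 * T (1 / 5) + e * (57 / 20 * kp ^+ 2).
Proof.
pose g (s : R) := 4 * s + 25 / 3 * ((s - 1 / 2) * ((s - 1 / 2) * (s - 1 / 2))).
pose f s := (P s + - (e / 2 * T s)) + - (e * kp ^+ 2 * g s).
have dg (s : R) : is_derive s 1 g (4 + 25 * ((s - 1 / 2) * (s - 1 / 2))).
  have t0 := derive_addE (is_derive_id s (1 : R)) (is_derive_cst (- (1 / 2) : R) s (1 : R)).
  have t1 := derive_mulE t0 (derive_mulE t0 t0).
  have t2 := derive_mulE (is_derive_cst (4 : R) s (1 : R)) (is_derive_id s (1 : R)).
  have t3 := derive_mulE (is_derive_cst (25 / 3 : R) s (1 : R)) t1.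
  by apply: (is_derive_eq (derive_addE t2 t3)); rewrite /=; field.
have df (s : R) : is_derive s 1 f ((dP s - e / 2 * dT s) -
    e * kp ^+ 2 * (4 + 25 * ((s - 1 / 2) * (s - 1 / 2)))).
  have t1 := derive_mulE (is_derive_cst (e / 2) s (1 : R)) (trace_primitive_deriv s).
  have t2 := derive_mulE (is_derive_cst (e * kp ^+ 2) s (1 : R)) (dg s).
  apply: (is_derive_eq (derive_addE (derive_addE (interpolant_deriv s) (derive_oppE t1)) (derive_oppE t2))).
  by rewrite /=; ring.
have : f (4 / 5) <= f (1 / 5).
  apply: (derive_le0_nincr _ df) => [|s /andP[s0 s1]]; first by lra.
  have hk := defect_rate_le s.
  have s_gt0 : 0 < s by lra.
  have s1_gt0 : 0 < 1 - s by lra.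
  have hh : h s <= kp / s * (kp / (1 - s)) * e.
    apply: pairing_le => [||i|j]; rewrite ?divr_ge0 ?expR_ge0 ?(ltW s_gt0) ?(ltW s1_gt0) //.
      exact: mul_decay_le.
    exact: mul_decay_le.
  have hg : kp / s * (kp / (1 - s)) * e <= e * kp ^+ 2 * (4 + 25 * ((s - 1 / 2) * (s - 1 / 2))).
    rewrite (_ : _ * e = e * kp ^+ 2 * (s * (1 - s))^-1); last first.
      by field; rewrite !gt_eqF.
    apply: ler_wpM2l; first by rewrite mulr_ge0 ?error_ge0 ?sqr_ge0.
    rewrite -[leLHS]div1r ler_pdivrMr ?mulr_gt0 // -subr_ge0.
    (* The last factor vanishes at [1 / 5] and [4 / 5], which makes 25 the least admissible
       coefficient. The increment of [g] is then [57 / 20]. *)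
    rewrite (_ : _ - 1 = (s - 1 / 2) ^+ 2 * (9 / 4 - 25 * (s - 1 / 2) ^+ 2)); last by field.
    by rewrite mulr_ge0 ?sqr_ge0 // expr2; nra.
  by lra.
rewrite /f /g; lra.
Qed.

Lemma interpolant_right_le : P 1 - e / 2 * T 1 - G3 1 - c1 / 5 <=
  P (4 / 5) - e / 2 * T (4 / 5) - G3 (4 / 5).
Proof.
pose f s := ((P s + - (e / 2 * T s)) + - G3 s) + - (c1 * s).
have df (s : R) : is_derive s 1 f (((dP s - e / 2 * dT s) - (h s - r3 s)) - c1).
  have t1 := derive_mulE (is_derive_cst (e / 2) s (1 : R)) (trace_primitive_deriv s).
  have t2 := derive_mulE (is_derive_cst c1 s (1 : R)) (is_derive_id s (1 : R)).
  apply: (is_derive_eq (derive_addE (derive_addE (derive_addE (interpolant_deriv s) (derive_oppE t1))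
    (derive_oppE (right_corrector_deriv s))) (derive_oppE t2))).
  by rewrite /=; ring.
have : f 1 <= f (4 / 5).
  apply: (derive_le0_nincr _ df) => [|s /andP[s0 s1]]; first by lra.
  have hk := defect_rate_le s.
  have hr : r3 s <= 25 / 4 * kp ^+ 2 / 2 * e.
    apply: shifted_pairing_le => [|i|j]; first by rewrite mulr_ge0 ?sqr_ge0 // divr_ge0.
      apply: (le_trans (sqr_mul_decay_le _ _)) => //; first by lra.
      by apply: inv_sqr_le; lra.
    by rewrite decay_ge0 decay_le1 // subr_ge0.
  by rewrite /c1; lra.
by rewrite /f; lra.
Qed.

(** At [s = 1] the interpolation ends with [(C + H) C^T] instead of the identity;
    [1 - (C + H) C^T = L D0 (1 - C C^T)] gives the extra terms. *)
Lemma compression_trace_interpolant :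
  \tr (U *m (dg (fun i => ex (x i) 1) - C *m dg (fun j => ex (y j) 1) *m C^T)) =
  P 1 - P 0 + (\sum_i (x i * ex (x i) 1) * Z i - pS (fun i j => (x i * ex (x i) 1) * 1 * K i j)).
Proof.
have P0E : P 0 = pS (fun i j => 1 * ex (y j) 1 * C i j).
  by apply: eq_pairing => i j; rewrite decay0 subr0 mul0r addr0.
have P1E : P 1 = pS (fun i j => ex (x i) 1 * 1 * (C + H) i j).
  by apply: eq_pairing => i j; rewrite subrr decay0 mul1r [(C + H) i j]mxE.
rewrite P0E P1E !pairing_trace diag_pairing_trace.
rewrite (_ : \row_i 1 = const_mx 1 :> 'rV[R]_m); last by apply/rowP => i; rewrite !mxE.
rewrite (_ : \row_i 1 = const_mx 1 :> 'rV[R]_n); last by apply/rowP => i; rewrite !mxE.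
rewrite !diag_const_mx !mulmx1 mul1mx.
have key : dg (fun i => ex (x i) 1) = dg (fun i => ex (x i) 1) *m (C + H) *m C^T +
    (dg (fun i => x i * ex (x i) 1) *m D0 - dg (fun i => x i * ex (x i) 1) *m K *m C^T).
  have -> : dg (fun i => x i * ex (x i) 1) = dg (fun i => ex (x i) 1) *m dg x.
    apply/matrixP => i j; rewrite mul_diag_mx !mxE.
    by case: eqP => [->|_]; rewrite ?mulr1n ?mulr0n; ring.
  rewrite /K /H -!mulmxA (mulmxA (dg x) D0) LD0 -!mulmxBr -!mulmxDr -[LHS]mulmx1.
  congr (_ *m _); rewrite NE !mulmxDl !mulmxBr !mulmxBl !mulmx1 !mul1mx !mulmxA ?mulNmx.
  move: (C *m C^T) (G *m C^T) (G *m C^T *m C *m C^T) => M1 M2 M3.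
  by apply/matrixP => i j; rewrite !mxE; ring.
rewrite mulmxBr raddfB /= {1}key mulmxDr mulmxBr mxtraceD raddfB /= !mulmxA.
by rewrite addrAC.
Qed.

(** The coefficient of [kp] is [5/8 + 1/2 + 5/8 + 1/2], from [G1] at [1/5] and [0], [G3] at [4/5],
    and the end [s = 1]. That of [kp^2] is [5/8 + 57/20 + 5/8], one term per time interval. The half
    count is the contribution of [N]. *)
Lemma compression_trace_le :
  \tr (U *m (dg (fun i => expR (- x i)) - C *m dg (fun j => expR (- y j)) *m C^T)) <=
  e * (9 / 4 * kp + 41 / 10 * kp ^+ 2 + #|[pred j | y j != 0]|%:R / 2).
Proof.
have exE a : expR (- a) = ex a 1 by rewrite /ex mulr1.
under eq_mx do rewrite exE.
have -> : (\row_j expR (- y j)) = \row_j ex (y j) 1 by apply/rowP => j; rewrite !mxE exE.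
rewrite compression_trace_interpolant.
have s1 := interpolant_left_le; have s2 := interpolant_middle_le; have s3 := interpolant_right_le; have sT := trace_primitive_diff.
have b1 : G1 (1 / 5) <= 1 / 2 * (5 / 4 * kp) * e.
  apply: pairing_le => [||i|j]; rewrite ?divr_ge0 ?mulr_ge0 ?divr_ge0 ?expR_ge0 //.
    by rewrite half_sub_decay_le // divr_ge0.
  apply: (le_trans (mul_decay_le _ _)) => //; first lra.
  by rewrite le_eqVlt; apply/orP; left; apply/eqP; field.
have b2 : - G1 0 <= 1 / 2 * kp * e.
  rewrite /G1 pairingN.
  rewrite (eq_pairing (g := fun i j => - (1 / 2 - ex (x i) 0) * (y j * ex (y j) (1 - 0)) * K i j)); last by move=> i j; ring.
  apply: pairing_le => [||i|j]; rewrite ?divr_ge0 ?expR_ge0 //.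
    by rewrite normrN half_sub_decay_le.
  apply: (le_trans (mul_decay_le _ _)) => //.
  by rewrite subr0 divr1.
have b3 : - G3 (4 / 5) <= 5 / 4 * kp / 2 * e.
  pose a i := - (x i * ex (x i) (4 / 5)).
  have -> : - G3 (4 / 5) = pS (fun i j => a i * ex (y j) (1 - 4 / 5) * K i j) -
      1 / 2 * \sum_i a i * Z i.
    rewrite /G3 opprB addrC pairingN -[- (1 / 2 * _)]mulrN -sumrN; congr (_ + _ * _).
      by apply: eq_pairing => i j; rewrite /a; ring.
    by apply: eq_bigr => i _; rewrite /a mulNr opprK.
  apply: shifted_pairing_le.
  - by rewrite mulr_ge0 ?divr_ge0 ?expR_ge0.
  - move=> i; rewrite normrN; apply: (le_trans (mul_decay_le _ _)) => //.
    by rewrite le_eqVlt; apply/orP; left; apply/eqP; field.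
  - by move=> j; rewrite decay_ge0 decay_le1 //; lra.
have b4 : \sum_i (x i * ex (x i) 1) * Z i <= kp * e.
  apply: diag_pairing_le => [|i]; first exact: expR_ge0.
  by apply: (le_trans (mul_decay_le _ _)) => //; rewrite divr1.
(* Added to the boundary terms of [compression_trace_interpolant], [G3 1] cancels the pairing with
   [K] and leaves half of the sum bounded in [b4]. This is the gain from correcting on the whole
   space. *)
have G31 : G3 1 = pS (fun i j => (x i * ex (x i) 1) * 1 * K i j) - 1 / 2 * \sum_i (x i * ex (x i) 1) * Z i.
  by rewrite /G3; congr (_ - _); apply: eq_pairing => i j; rewrite subrr decay0.
have e0 := error_ge0.
have sT' : e / 2 * T 1 - e / 2 * T 0 <= e * (#|[pred j | y j != 0]|%:R / 2).
  rewrite (_ : _ - _ = e * ((T 1 - T 0) / 2)); last by field.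
  by apply: ler_wpM2l => //; lra.
move: (pS _) (\sum_i _) G31 b4 => p0 z0 G31 b4.
rewrite /c1 in s1 s3.
lra.
Qed.

End Core.

(** * Dirichlet form of a reversible chain *)

Section Energy.
Variables (R : realType) (n : nat) (Q : 'M[R]_n) (mu : 'rV[R]_n).
Hypothesis rateQ : is_rate_matrix Q.
Hypothesis irrQ : irreducible_rates Q.
Hypothesis statQ : is_stationary Q mu.
Hypothesis revQ : is_reversible Q mu.
Implicit Types u v : 'I_n -> R.

Definition generator u i := \sum_k Q i k * u k.

Definition dirichlet u v := - \sum_i mu 0 i * (u i * generator v i).

Lemma mu_gt0 i : 0 < mu 0 i.
Proof. by case: statQ. Qed.

Lemma rate_balance i k : mu 0 i * Q i k = mu 0 k * Q k i.
Proof.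
have /matrixP/(_ i k) := revQ; rewrite mul_diag_mx mul_mx_diag !mxE => ->.
exact: mulrC.
Qed.

Lemma rate_row_sum i : \sum_k Q i k = 0.
Proof.
have [_ /matrixP/(_ i 0)] := rateQ; rewrite !mxE => e.
by rewrite -[RHS]e; apply: eq_bigr => k _; rewrite mxE mulr1.
Qed.

(** Zero row sums remove the terms that depend on one index, and reversibility identifies the two
    cross terms. *)
Lemma dirichletE u v : dirichlet u v =
  1 / 2 * \sum_i \sum_k mu 0 i * Q i k * ((u i - u k) * (v i - v k)).
Proof.
pose s (w : 'I_n -> 'I_n -> R) := \sum_i \sum_k mu 0 i * Q i k * w i k.
have s0 w : s (fun i k => w i) = 0.
  rewrite /s big1 // => i _; rewrite -mulr_suml -mulr_sumr rate_row_sum.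
  by rewrite mulr0 mul0r.
have sC w : s (fun i k => w k i) = s w.
  rewrite /s exchange_big /=; apply: eq_bigr => i _; apply: eq_bigr => k _.
  by rewrite rate_balance.
have -> : dirichlet u v = - s (fun i k => u i * v k).
  rewrite /dirichlet; congr (- _); apply: eq_bigr => i _.
  by rewrite /generator !mulr_sumr; apply: eq_bigr => k _; ring.
have -> : \sum_i \sum_k mu 0 i * Q i k * ((u i - u k) * (v i - v k)) =
    s (fun i _ => u i * v i) + s (fun _ k => u k * v k)
    - s (fun i k => u i * v k) - s (fun i k => u k * v i).
  rewrite /s -!sumrN -!big_split /=; apply: eq_bigr => i _.
  by rewrite -!sumrN -!big_split /=; apply: eq_bigr => k _; ring.
rewrite (sC (fun k _ => u k * v k)) s0 (sC (fun i k => u i * v k)).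
by field.
Qed.

Lemma dirichletC u v : dirichlet u v = dirichlet v u.
Proof.
rewrite !dirichletE; congr (_ * _); apply: eq_bigr => i _; apply: eq_bigr => k _.
by ring.
Qed.

Lemma dirichlet_le u v u' v' :
  (forall i k, (u i - u k) * (v i - v k) <= (u' i - u' k) * (v' i - v' k)) ->
  dirichlet u v <= dirichlet u' v'.
Proof.
move=> le; rewrite !dirichletE ler_wpM2l ?divr_ge0 // ler_sum // => i _.
rewrite ler_sum // => k _; have [->|ik] := eqVneq i k; first by rewrite !subrr !mul0r.
by rewrite ler_wpM2l // mulr_ge0 ?(ltW (mu_gt0 _)) //; case: rateQ => h _; exact: h.
Qed.

Lemma dirichlet_ge0 u : 0 <= dirichlet u u.
Proof.
have -> : 0 = dirichlet (fun _ => 0) (fun _ => 0).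
  by rewrite /dirichlet big1 ?oppr0 // => i _; rewrite mul0r mulr0.
by apply: dirichlet_le => i k; rewrite subrr mul0r -expr2 sqr_ge0.
Qed.

(** Zero energy makes [u] equal across every edge of positive rate, and irreducibility joins [i0] to
    every state by such edges. *)
Lemma dirichlet_eq0 u i0 : dirichlet u u <= 0 -> u i0 = 0 -> forall i, u i = 0.
Proof.
move=> E0 ui0 i; have /connectP[p pth ->] := irrQ i0 i.
elim: p i0 ui0 pth => [//|k p IHp] i0 ui0 /= /andP[Qk]; apply: IHp.
have [<-//|ik] := eqVneq i0 k.
have : dirichlet u u = 0 by apply/eqP; rewrite eq_le E0 dirichlet_ge0.
have pos (a b : 'I_n) : 0 <= mu 0 a * Q a b * ((u a - u b) * (u a - u b)).
  have [->|ab] := eqVneq a b; first by rewrite subrr mul0r mulr0.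
  rewrite mulr_ge0 -?expr2 ?sqr_ge0 // mulr_ge0 ?(ltW (mu_gt0 _)) //.
  by case: rateQ => h _; exact: h.
rewrite dirichletE => /eqP; rewrite mulf_eq0 => /orP[/eqP|]; first by lra.
rewrite psumr_eq0; last by move=> a _; rewrite sumr_ge0.
move/allP/(_ i0 (mem_index_enum _)); rewrite /= psumr_eq0 //.
move/allP/(_ k (mem_index_enum _)) => /=.
rewrite !mulf_eq0 (gt_eqF (mu_gt0 _)) (gt_eqF Qk) /= orbb subr_eq0 ui0.
by move/eqP.
Qed.

(** The negative part [v] vanishes on [S], so [E(u, v) = 0]. Edge by edge [(u_a - u_b)(v_a - v_b) <=
    - (v_a - v_b)^2], hence [E(v, v) <= 0] and [v] is zero. *)
Lemma minimum_principle (S : pred 'I_n) u i0 : i0 \in S ->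
  (forall i, i \in S -> 0 <= u i) -> (forall i, i \notin S -> generator u i = 0) ->
  forall i, 0 <= u i.
Proof.
move=> Si0 uS gS i; pose v k := Num.max (- u k) 0.
have v0 : v i0 = 0 by rewrite /v; apply/max_idPr; rewrite oppr_le0 uS.
suff : v i = 0 by rewrite /v => /max_idPr; rewrite oppr_le0.
apply: dirichlet_eq0 v0 _.
have : dirichlet u v = 0.
  rewrite dirichletC /dirichlet big1 ?oppr0 // => k _.
  have [kS|kS] := boolP (k \in S); last by rewrite gS // !mulr0.
  have -> : v k = 0 by rewrite /v; apply/max_idPr; rewrite oppr_le0 uS.
  by rewrite mul0r mulr0.
have : dirichlet u v <= dirichlet (fun k => - v k) v.
  apply: dirichlet_le => a b; rewrite /v.
  by case: (leP (- u a) 0) => ha; case: (leP (- u b) 0) => hb; nra.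
have -> : dirichlet (fun k => - v k) v = - dirichlet v v.
  by rewrite /dirichlet opprK -sumrN; apply: eq_bigr => k _; ring.
lra.
Qed.

Lemma generatorD u v i : generator (fun k => u k + v k) i = generator u i + generator v i.
Proof. by rewrite /generator -big_split /=; apply: eq_bigr => k _; rewrite mulrDr. Qed.

Lemma generatorZ c u i : generator (fun k => c * u k) i = c * generator u i.
Proof. by rewrite /generator mulr_sumr; apply: eq_bigr => k _; rewrite mulrCA. Qed.

Lemma generator_const c i : generator (fun _ => c) i = 0.
Proof. by rewrite /generator -mulr_suml rate_row_sum mul0r. Qed.

Lemma generator_sum m (f : 'I_m -> R) (F : 'I_m -> 'I_n -> R) i :
  generator (fun k => \sum_j F j k * f j) i = \sum_j generator (F j) i * f j.
Proof.
rewrite /generator; under eq_bigr do rewrite mulr_sumr.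
rewrite exchange_big /=; apply: eq_bigr => j _; rewrite mulr_suml.
by apply: eq_bigr => k _; rewrite mulrA.
Qed.

End Energy.

(** * Green matrix of the killed chain *)

Section Green.
Variables (R : realType) (n : nat) (Q : 'M[R]_n) (mu : 'rV[R]_n).
Hypothesis rateQ : is_rate_matrix Q.
Hypothesis irrQ : irreducible_rates Q.
Hypothesis statQ : is_stationary Q mu.
Hypothesis revQ : is_reversible Q mu.
Let h i := Num.sqrt (mu 0 i).
Let L := laplacian Q mu.

Lemma invmx_diag k (d : 'rV[R]_k) : (forall i, d 0 i != 0) ->
  invmx (diag_mx d) = diag_mx (map_mx GRing.inv d).
Proof.
move=> d0; have dd : diag_mx d *m diag_mx (map_mx GRing.inv d) = 1%:M.
  apply/matrixP => i j; rewrite mul_diag_mx !mxE.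
  by case: eqP => [->|_]; rewrite ?mulr1n ?mulr0n ?mulr0 // divff.
have [du _] := mulmx1_unit dd.
by rewrite -[LHS]mulmx1 -dd mulKmx.
Qed.

Lemma sqrt_mu_gt0 i : 0 < h i.
Proof. by rewrite sqrtr_gt0 (mu_gt0 statQ). Qed.

Lemma sqrt_mu_sqr i : h i ^+ 2 = mu 0 i.
Proof. by rewrite sqr_sqrtr // ltW // (mu_gt0 statQ). Qed.

Lemma laplacianE i j : L i j = - (h i * Q i j / h j).
Proof.
rewrite /L /laplacian invmx_diag => [|k]; last by rewrite mxE gt_eqF ?sqrt_mu_gt0.
by rewrite mxE mul_mx_diag mul_diag_mx !mxE.
Qed.

Lemma laplacian_sym : L^T = L.
Proof.
apply/matrixP => i j; rewrite mxE !laplacianE; congr (- _).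
have hi := sqrt_mu_gt0 i; have hj := sqrt_mu_gt0 j.
have := rate_balance revQ i j; rewrite -!sqrt_mu_sqr => e.
apply: (mulIf (x := h i * h j)); first by rewrite mulf_neq0 ?gt_eqF.
transitivity (h j ^+ 2 * Q j i); first by field; rewrite gt_eqF.
by rewrite -e; field; rewrite gt_eqF.
Qed.

Lemma laplacian_mulE (v : 'cV[R]_n) i :
  (L *m v) i 0 = - h i * generator Q (fun k => v k 0 / h k) i.
Proof.
rewrite mxE /generator mulr_sumr; apply: eq_bigr => k _.
by rewrite laplacianE; field; rewrite gt_eqF ?sqrt_mu_gt0.
Qed.

Lemma laplacian_quad (v w : 'cV[R]_n) :
  (v^T *m L *m w) 0 0 = dirichlet Q mu (fun k => v k 0 / h k) (fun k => w k 0 / h k).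
Proof.
rewrite quadE /dirichlet -sumrN; apply: eq_bigr => i _.
rewrite laplacian_mulE -sqrt_mu_sqr.
by field; rewrite gt_eqF ?sqrt_mu_gt0.
Qed.

Lemma laplacian_psd : psd L.
Proof.
split; first exact: laplacian_sym.
by move=> v; rewrite laplacian_quad (dirichlet_ge0 rateQ statQ revQ).
Qed.

Lemma laplacian_quad_eq0 (v : 'cV[R]_n) i0 : (v^T *m L *m v) 0 0 <= 0 ->
  v i0 0 = 0 -> v = 0.
Proof.
rewrite laplacian_quad => E0 v0; apply/colP => i; rewrite [RHS]mxE.
have := dirichlet_eq0 rateQ irrQ statQ revQ E0 (i0 := i0) _ i.
rewrite v0 mul0r => /(_ erefl)/eqP; rewrite mulf_eq0 invr_eq0.
by rewrite (gt_eqF (sqrt_mu_gt0 _)) orbF => /eqP.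
Qed.

Variable I : {set 'I_n}.
Hypothesis I_gt0 : (0 < #|I|)%N.

Let pj : 'M[R]_n := diag_mx (\row_i (i \notin I)%:R).

Lemma projE m (A : 'M[R]_(n, m)) i j : (pj *m A) i j = (i \notin I)%:R * A i j.
Proof. by rewrite mul_diag_mx !mxE. Qed.

Lemma proj_idem : pj *m pj = pj.
Proof.
apply/matrixP => i j; rewrite projE !mxE.
by case: (i \notin I); rewrite ?mul1r ?mul0r //= mul0rn.
Qed.

(* [L] off [I], and the identity on [I] *)
Let B := pj *m L *m pj + (1%:M - pj).

(** A null vector vanishes on [I] and has zero energy, hence is zero; this needs [I] nonempty. *)
Lemma killed_unit : B \in unitmx.
Proof.
have BT : B^T = B.
  rewrite /B [LHS]linearD /= [(1%:M - _)^T]linearB /= trmx1 !trmx_mul.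
  by rewrite tr_diag_mx laplacian_sym mulmxA.
rewrite -row_free_unit -kermx_eq0; apply/rowV0P => u /sub_kermxP uB.
pose v := u^T; have Bv : B *m v = 0 by rewrite -BT -trmx_mul uB trmx0.
have v0 i : i \in I -> v i 0 = 0.
  move=> iI; have /colP/(_ i) := Bv; rewrite /B mulmxDl mulmxBl mul1mx.
  rewrite -!mulmxA mxE [X in _ + X]mxE [X in _ + (_ + X)]mxE !projE iI !mul0r.
  by rewrite oppr0 addr0 add0r => ->; rewrite mxE.
have pv : pj *m v = v.
  apply/colP => i; rewrite projE; case: (boolP (i \in I)) => [/v0 ->|_].
    by rewrite mulr0.
  by rewrite mul1r.
have /card_gt0P[i0 i0I] := I_gt0.
suff : v = 0 by move=> v00; rewrite -[u]trmxK -/v v00 trmx0.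
apply: (@laplacian_quad_eq0 _ i0); last exact: v0.
have : (v^T *m (B *m v)) 0 0 = 0 by rewrite Bv mulmx0 mxE.
rewrite /B mulmxDl mulmxBl mul1mx -!mulmxA pv subrr addr0 (mulmxA v^T pj).
have -> : v^T *m pj = v^T by rewrite -[pj]tr_diag_mx -trmx_mul pv.
by rewrite mulmxA => ->.
Qed.

(* The inverse of the block of [L] off [I], padded by zeros *)
Definition green := invmx B *m pj.

Lemma killed_commute : pj *m B = B *m pj.
Proof.
rewrite /B mulmxDr mulmxDl mulmxBr mulmxBl !mulmxA mulmx1 mul1mx proj_idem subrr.
by rewrite -!mulmxA proj_idem mulmxA.
Qed.

Lemma greenE : green = pj *m invmx B.
Proof.
rewrite -[LHS](mulmxK killed_unit) /green -(mulmxA _ pj) killed_commute !mulmxA.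
by rewrite mulVmx ?killed_unit // mul1mx.
Qed.

Lemma green_proj : pj *m green = green.
Proof. by rewrite greenE mulmxA proj_idem. Qed.

Lemma green_sym : green^T = green.
Proof.
rewrite {1}/green trmx_mul tr_diag_mx trmx_inv greenE; congr (_ *m invmx _).
rewrite /B [LHS]linearD /= [(1%:M - _)^T]linearB /= trmx1 !trmx_mul.
by rewrite tr_diag_mx laplacian_sym mulmxA.
Qed.

Lemma green_I i j : i \in I -> green i j = 0.
Proof. by move=> iI; rewrite -green_proj projE iI mul0r. Qed.

Lemma proj_laplacian_green : pj *m L *m green = pj.
Proof.
have : pj *m (B *m green) = pj *m pj.
  by rewrite /green (mulmxA B) mulmxV ?killed_unit // mul1mx.
rewrite proj_idem /B mulmxDl mulmxBl mul1mx green_proj subrr addr0.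
by rewrite -!mulmxA green_proj !mulmxA proj_idem.
Qed.

Lemma laplacian_green i j : i \notin I -> (L *m green) i j = (i == j)%:R.
Proof.
move=> iI; have /matrixP/(_ i j) := proj_laplacian_green.
by rewrite -mulmxA projE iI mul1r => ->; rewrite !mxE iI.
Qed.

Lemma green_mul : green *m L *m green = green.
Proof.
have -> : green *m L = green *m (pj *m L).
  by rewrite mulmxA -[in RHS]green_sym -[pj]tr_diag_mx -trmx_mul green_proj green_sym.
by rewrite -mulmxA proj_laplacian_green -[in LHS]green_sym -[pj]tr_diag_mx -trmx_mul green_proj green_sym.
Qed.

Lemma green_psd : psd green.
Proof.
split=> [|v]; first exact: green_sym.
have -> : v^T *m green *m v = (green *m v)^T *m L *m (green *m v).
  by rewrite trmx_mul green_sym -{1}green_mul !mulmxA.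
by have [_] := laplacian_psd; apply.
Qed.

End Green.

(** * Harmonic extension from the target set *)

Section Harmonic.
Variables (R : realType) (n : nat) (Q : 'M[R]_n) (mu : 'rV[R]_n).
Hypothesis rateQ : is_rate_matrix Q.
Hypothesis irrQ : irreducible_rates Q.
Hypothesis statQ : is_stationary Q mu.
Hypothesis revQ : is_reversible Q mu.
Variable I : {set 'I_n}.
Hypothesis I_gt0 : (0 < #|I|)%N.
Variable Ct : 'M[R]_(n, #|I|).
Hypothesis Ct_ge0 : forall i j, 0 <= Ct i j.
Hypothesis Ct_I : forall k j, Ct (enum_val k) j = (k == j)%:R.
Hypothesis Ct_harmonic : forall i j, i \notin I -> (Q *m Ct) i j = 0.
Let h i := Num.sqrt (mu 0 i).
Let L := laplacian Q mu.
Let D0 := green Q mu I.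
Let ev (k : 'I_#|I|) : 'I_n := enum_val k.
Let E := dirichlet Q mu.
Let ct j : 'I_n -> R := fun i => Ct i j.

Lemma ev_in k : ev k \in I.
Proof. exact: enum_valP. Qed.

Lemma ev_surj i : i \in I -> exists k, i = ev k.
Proof. by move=> iI; exists (enum_rank_in iI i); rewrite /ev enum_rankK_in. Qed.

Lemma generator_ct i j : i \notin I -> generator Q (ct j) i = 0.
Proof. by move=> iI; rewrite -(Ct_harmonic j iI) mxE. Qed.

(** [\sum_j ct j - 1] vanishes on [I] and is harmonic off [I], so its energy is zero. That [I] is
    hit almost surely thus follows from harmonicity alone. *)
Lemma committor_row_sum i : \sum_j Ct i j = 1.
Proof.
pose u i := \sum_j ct j i * 1 + (-1) * 1.
have uI k : u (ev k) = 0.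
  rewrite /u (bigD1 k) //= big1 => [|j jk]; last by rewrite /ct Ct_I eq_sym (negbTE jk) mul0r.
  by rewrite /ct Ct_I eqxx addr0 !mulr1 subrr.
have gu k : k \notin I -> generator Q u k = 0.
  move=> kI; rewrite /u generatorD generatorZ (generator_const rateQ) mulr0 addr0.
  rewrite generator_sum big1 // => j _; by rewrite generator_ct // mul0r.
have E0 : dirichlet Q mu u u <= 0.
  rewrite /dirichlet big1 ?oppr0 // => k _.
  have [/ev_surj[l ->]|kI] := boolP (k \in I); first by rewrite uI mul0r mulr0.
  by rewrite gu // !mulr0.
have /card_gt0P[i0 /ev_surj[k0 i0E]] := I_gt0.
have := dirichlet_eq0 rateQ irrQ statQ revQ E0 (uI k0) i.
rewrite /u; under eq_bigr do rewrite mulr1.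
by move/eqP; rewrite mulN1r addr_eq0 opprK => /eqP.
Qed.

Section Variance.
Variable l : 'I_n.
Hypothesis lI : l \notin I.
Let dl := D0 l l.
(** [g / dl] is the probability of reaching [l] before [I]: [g] is zero on [I], [dl] at [l], and
    harmonic elsewhere. *)
Let g a := D0 a l * h l / h a.

Let h_neq0 i : h i != 0.
Proof. by rewrite gt_eqF // (sqrt_mu_gt0 statQ). Qed.

Lemma green_diag_ge0 i : 0 <= D0 i i.
Proof. by apply: psd_diag_ge0; exact: green_psd. Qed.

Lemma hitting_green_I a : a \in I -> g a = 0.
Proof. by move=> aI; rewrite /g /D0 (green_I rateQ irrQ statQ revQ I_gt0) // !mul0r. Qed.

Lemma hitting_green_l : g l = dl.
Proof. by rewrite /g mulfK. Qed.

Lemma generator_green i : i \notin I -> generator Q g i = - (i == l)%:R.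
Proof.
move=> iI; have := laplacian_green rateQ irrQ statQ revQ I_gt0 l iI.
rewrite mxE => e.
have -> : generator Q g i = - (h l / h i) * \sum_k L i k * D0 k l.
  rewrite /generator mulr_sumr; apply: eq_bigr => k _.
  by rewrite /L (laplacianE statQ) /g -/(h i) -/(h k); field; rewrite !h_neq0.
by rewrite e; case: eqVneq => [->|_]; rewrite ?mulr0 ?oppr0 // mulr1 divff.
Qed.

(** Evaluate [E(g, ct j) = 0] from the other side: only [ev j], where [ct j] is 1, and the source
    [l] of [g] contribute. *)
Lemma hitting_flux j : mu 0 (ev j) * generator Q g (ev j) = mu 0 l * Ct l j.
Proof.
have : E g (ct j) = 0.
  rewrite /E /dirichlet big1 ?oppr0 // => i _.
  have [iI|iI] := boolP (i \in I); first by rewrite hitting_green_I // mul0r mulr0.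
  by rewrite generator_ct // !mulr0.
have ll : l != ev j by apply: contraNneq lI => ->; exact: ev_in.
rewrite /E (dirichletC rateQ revQ) /dirichlet (bigD1 (ev j)) //= (bigD1 l) //= big1 => [|i].
  rewrite /ct Ct_I (generator_green lI) !eqxx mul1r /= mulr1n; lra.
case/andP=> ij il; have [/ev_surj[k ik]|iI] := boolP (i \in I).
  rewrite /ct ik Ct_I (_ : k == j = false) ?mul0r ?mulr0 //.
  by apply: contraNF ij => /eqP <-; rewrite ik.
by rewrite generator_green // (negbTE il) oppr0 !mulr0.
Qed.

(* The chain started at [a] may reach [l] first, and then hit [I] at [j]. *)
Lemma committor_hitting_le j a : 0 <= dl * Ct a j + (- Ct l j) * g a.
Proof.
have dl0 := green_diag_ge0 l.
pose u a := dl * ct j a + (- Ct l j) * g a.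
have /card_gt0P[i0 i0I] := I_gt0.
apply: (@minimum_principle _ _ Q mu rateQ irrQ statQ revQ
  [pred i | (i \in I) || (i == l)] u i0 _ _ _ a).
- by rewrite inE i0I.
- move=> i; rewrite inE => /orP[iI|/eqP ->].
    by rewrite /u hitting_green_I // mulr0 addr0 mulr_ge0 // Ct_ge0.
  by rewrite /u hitting_green_l /ct mulrC mulNr subrr.
- move=> i; rewrite inE negb_or => /andP[iI il].
  rewrite /u generatorD !generatorZ generator_ct // generator_green // (negbTE il).
  by rewrite oppr0 !mulr0 addr0.
Qed.

Let S j k := E (ct j) (ct k).

Lemma committor_energyE j k : S j k = - (mu 0 (ev j) * generator Q (ct k) (ev j)).
Proof.
rewrite /S /E /dirichlet (bigD1 (ev j)) //= big1 ?addr0 => [|i ij].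
  by rewrite /ct Ct_I eqxx mul1r.
have [/ev_surj[k' ik]|iI] := boolP (i \in I).
  rewrite /ct ik Ct_I (_ : k' == j = false) ?mul0r ?mulr0 //.
  by apply: contraNF ij => /eqP <-; rewrite ik.
by rewrite generator_ct // !mulr0.
Qed.

(** By [committor_hitting_le], [u = dl ct_k - Ct_lk g] is nonnegative; it vanishes at [ev j], so the
    generator is nonnegative there. [hitting_flux] evaluates the part in [g]. *)
Lemma committor_energy_le j k : j != k -> dl * S j k + mu 0 l * (Ct l j * Ct l k) <= 0.
Proof.
move=> jk; pose u a := dl * ct k a + (- Ct l k) * g a.
have u0 : u (ev j) = 0.
  by rewrite /u /ct Ct_I (negbTE jk) hitting_green_I ?ev_in // !mulr0 addr0.
have : 0 <= mu 0 (ev j) * generator Q u (ev j).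
  rewrite mulr_ge0 ?(ltW (mu_gt0 statQ _)) // sumr_ge0 // => i _.
  have [<-|ij] := eqVneq (ev j) i; first by rewrite u0 mulr0.
  rewrite mulr_ge0 //; last exact: committor_hitting_le.
  by case: rateQ => Q0 _; exact: Q0.
rewrite /u generatorD !generatorZ mulrDr (mulrCA _ (- _)) hitting_flux.
rewrite committor_energyE; lra.
Qed.

Lemma committor_energy_row_sum j : \sum_k S j k = 0.
Proof.
under eq_bigr do rewrite committor_energyE.
rewrite sumrN -mulr_sumr.
have -> : \sum_k generator Q (ct k) (ev j) = generator Q (fun i => \sum_k ct k i * 1) (ev j).
  by rewrite generator_sum; apply: eq_bigr => k _; rewrite mulr1.
have -> : (fun i => \sum_k ct k i * 1) = fun=> 1.
  apply/funext => i; rewrite -[RHS](committor_row_sum i).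
  by apply: eq_bigr => k _; rewrite mulr1.
by rewrite (generator_const rateQ) mulr0 oppr0.
Qed.

(** [u l] is the mean of [f] under the law of the first hit from [l]. Centering [f] leaves the
    energy unchanged and removes the rank-one part of [t]. *)
Lemma variance_le_energy (f : 'I_#|I| -> R) u :
  u = (fun i => \sum_j ct j i * f j) ->
  mu 0 l * \sum_j Ct l j * (f j - u l) ^+ 2 <= dl * E u u.
Proof.
move=> uE; have {}uE i : u i = \sum_j ct j i * f j by rewrite uE.
pose a j := f j - u l.
have pa : \sum_j Ct l j * a j = 0.
  rewrite /a; under eq_bigr do rewrite mulrBr.
  by rewrite sumrB -mulr_suml committor_row_sum mul1r uE subrr.
have Ev : E u u = \sum_j \sum_k S j k * (a j * a k).
  pose v i := \sum_j ct j i * a j.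
  have vE i : v i = u i - u l.
    rewrite /v /a; under eq_bigr do rewrite mulrBr.
    by rewrite sumrB -mulr_suml committor_row_sum mul1r -uE.
  transitivity (E v v).
    rewrite /E !(dirichletE rateQ revQ); congr (_ * _); apply: eq_bigr => i _.
    by apply: eq_bigr => k _; rewrite !vE; ring.
  rewrite /E /dirichlet.
  have -> : \sum_i mu 0 i * (v i * generator Q v i) =
      \sum_i \sum_j \sum_k mu 0 i * (ct j i * generator Q (ct k) i) * (a j * a k).
    apply: eq_bigr => i _; rewrite {2}/v generator_sum /v mulr_suml mulr_sumr.
    by apply: eq_bigr => j _; rewrite !mulr_sumr; apply: eq_bigr => k _; ring.
  rewrite exchange_big -sumrN; apply: eq_bigr => j _ /=.
  rewrite exchange_big -sumrN; apply: eq_bigr => k _ /=.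
  by rewrite /S /E /dirichlet mulNr mulr_suml.
(* [t] has nonpositive off-diagonal entries and row sums [mu_l p_j]. *)
pose t j k := dl * S j k + mu 0 l * (Ct l j * Ct l k).
have tC j k : t j k = t k j.
  by rewrite /t /S /E (dirichletC rateQ revQ) (mulrC (Ct l j)).
have row j : \sum_k t j k = mu 0 l * Ct l j.
  rewrite /t big_split /= -!mulr_sumr committor_energy_row_sum mulr0 add0r.
  by rewrite committor_row_sum mulr1.
have e1 : dl * E u u = \sum_j \sum_k t j k * (a j * a k).
  have -> : \sum_j \sum_k t j k * (a j * a k) = \sum_j \sum_k dl * (S j k * (a j * a k)) +
      mu 0 l * ((\sum_j Ct l j * a j) * \sum_k Ct l k * a k).
    rewrite mulr_suml mulr_sumr -big_split /=; apply: eq_bigr => j _.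
    rewrite !mulr_sumr -big_split /=; apply: eq_bigr => k _.
    by rewrite /t; ring.
  rewrite pa mul0r mulr0 addr0 Ev mulr_sumr; apply: eq_bigr => j _.
  by rewrite mulr_sumr.
have e2 : mu 0 l * \sum_j Ct l j * a j ^+ 2 = \sum_j \sum_k t j k * a j ^+ 2.
  by rewrite mulr_sumr; apply: eq_bigr => j _; rewrite -mulr_suml row mulrA.
have e3 : \sum_j \sum_k t j k * a j ^+ 2 = \sum_j \sum_k t j k * a k ^+ 2.
  by rewrite exchange_big /=; apply: eq_bigr => j _; apply: eq_bigr => k _; rewrite tC.
(* A symmetric matrix with nonpositive off-diagonal entries dominates, as a form, the diagonal
   matrix of its row sums. *)
have : 0 <= \sum_j \sum_k (- t j k) * (a j - a k) ^+ 2.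
  apply: sumr_ge0 => j _; apply: sumr_ge0 => k _.
  have [->|jk] := eqVneq j k; first by rewrite subrr expr0n mulr0.
  by rewrite mulr_ge0 ?sqr_ge0 // oppr_ge0; exact: committor_energy_le.
have -> : \sum_j \sum_k (- t j k) * (a j - a k) ^+ 2 =
    2 * (\sum_j \sum_k t j k * (a j * a k)) - (\sum_j \sum_k t j k * a j ^+ 2) -
    (\sum_j \sum_k t j k * a k ^+ 2).
  rewrite mulr_sumr -!sumrN -!big_split /=; apply: eq_bigr => j _.
  rewrite mulr_sumr -!sumrN -!big_split /=; apply: eq_bigr => k _; ring.
rewrite -e3 -e1 -e2; rewrite -[\sum_j Ct l j * (f j - u l) ^+ 2]/(\sum_j Ct l j * a j ^+ 2).
lra.
Qed.

End Variance.

(** * The weighted committor, its intertwining relations and its defect *)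

Let hh j := Num.sqrt ((mu *m Ct) 0 j).
Let C : 'M[R]_(n, #|I|) := diag_mx (map_mx Num.sqrt mu) *m Ct *m
  invmx (diag_mx (map_mx Num.sqrt (mu *m Ct))).
Let Lh := C^T *m L *m C.
(** Supported on [I] and scaled so that [G^T C = 1]. *)
Let G : 'M[R]_(n, #|I|) := \matrix_(i, k) ((i == ev k)%:R * (hh k / h i)).
Let N := 1%:M - C^T *m C.

Let h_gt0 i : 0 < h i.
Proof. exact: (sqrt_mu_gt0 statQ). Qed.

Let h_neq0 i : h i != 0.
Proof. by rewrite gt_eqF. Qed.

Lemma weight_gt0 j : 0 < (mu *m Ct) 0 j.
Proof.
rewrite mxE (bigD1 (ev j)) //= Ct_I eqxx mulr1.
apply: ltr_pwDl; first exact: (mu_gt0 statQ).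
by apply: sumr_ge0 => i _; rewrite mulr_ge0 // ltW // (mu_gt0 statQ).
Qed.

Let hh_gt0 j : 0 < hh j.
Proof. by rewrite sqrtr_gt0 weight_gt0. Qed.

Let hh_neq0 j : hh j != 0.
Proof. by rewrite gt_eqF. Qed.

Lemma weight_sqr j : hh j ^+ 2 = \sum_i mu 0 i * Ct i j.
Proof. by rewrite sqr_sqrtr ?ltW ?weight_gt0 // mxE. Qed.

Lemma compressionE i j : C i j = h i * Ct i j / hh j.
Proof.
rewrite /C invmx_diag => [|k]; last by rewrite mxE hh_neq0.
rewrite /hh; move: (mu *m Ct) => W.
by rewrite mul_mx_diag mul_diag_mx !mxE.
Qed.

Lemma compression_I k j : C (ev k) j = (k == j)%:R * (h (ev k) / hh j).
Proof. by rewrite compressionE Ct_I; ring. Qed.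

Lemma laplacian_compression0 i j : i \notin I -> (L *m C) i j = 0.
Proof.
move=> iI; have -> : (L *m C) i j = - (h i / hh j) * (Q *m Ct) i j.
  rewrite !mxE mulr_sumr; apply: eq_bigr => k _.
  by rewrite /L (laplacianE statQ) compressionE -/(h i) -/(h k); field; rewrite h_neq0 hh_neq0.
by rewrite Ct_harmonic // mulr0.
Qed.

Lemma compression_sum (F : 'I_n -> R) k :
  \sum_i C i k * F i = h (ev k) / hh k * F (ev k) + \sum_(i | i \notin I) C i k * F i.
Proof.
rewrite (bigID [pred i | i \in I]) /=; congr (_ + _).
rewrite (bigD1 (ev k)) ?ev_in //= big1 ?addr0.
  by rewrite compression_I eqxx mul1r.
move=> i /andP[/ev_surj[l ->] lk]; rewrite compression_I (_ : l == k = false) ?mul0r //.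
by apply: contraNF lk => /eqP ->.
Qed.

(** [L C] vanishes off [I], and [C] is diagonal on [I], so the rows of [L C] in [I] can be read off
    [C^T L C]. *)
Lemma laplacian_compression : L *m C = G *m Lh.
Proof.
apply/matrixP => i j; have [/ev_surj[k ->]|iI] := boolP (i \in I).
  rewrite [RHS]mxE (bigD1 k) //= big1 ?addr0 => [|l lk]; last first.
    rewrite mxE (_ : ev k == ev l = false) ?mul0r //.
    by apply: contraNF lk => /eqP/enum_val_inj ->.
  rewrite [G _ _]mxE eqxx mul1r /Lh -mulmxA [(C^T *m _) k j]mxE.
  under eq_bigr do rewrite mxE.
  rewrite compression_sum // big1 => [|l lI]; last by rewrite laplacian_compression0 ?mulr0.
  by rewrite addr0; field; rewrite h_neq0 hh_neq0.
rewrite laplacian_compression0 // mxE big1 // => k _.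
rewrite mxE (_ : i == ev k = false) ?mul0r //.
by apply: contraNF iI => /eqP ->; exact: ev_in.
Qed.

Lemma green_G : G^T *m D0 = 0.
Proof.
apply/matrixP => k j; rewrite mxE [RHS]mxE big1 // => i _; rewrite [G^T _ _]mxE [G _ _]mxE.
have [->|_] := eqVneq i (ev k); last by rewrite !mul0r.
by rewrite /D0 (green_I rateQ irrQ statQ revQ I_gt0) ?ev_in // mulr0.
Qed.

(** Off [I] the product [L D0] is the identity. The rows in [I] are then determined by
    [C^T L D0 = 0], which holds since [L C] is supported where [D0] vanishes. *)
Lemma laplacian_green_compression : L *m D0 = 1%:M - G *m C^T.
Proof.
have GC i j : (G *m C^T) i j = \sum_k (i == ev k)%:R * (hh k / h i) * C j k.
  by rewrite mxE; apply: eq_bigr => k _; rewrite !mxE.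
have z : C^T *m (L *m D0) = 0.
  rewrite mulmxA -[C^T *m L]trmxK trmx_mul trmxK (laplacian_sym statQ revQ).
  by rewrite laplacian_compression trmx_mul -mulmxA green_G mulmx0.
apply/matrixP => i j; rewrite [RHS]mxE [X in _ = X + _]mxE [X in _ = _ + X]mxE GC.
have [/ev_surj[k ->]|iI] := boolP (i \in I); last first.
  rewrite (laplacian_green rateQ irrQ statQ revQ I_gt0) // big1 ?subr0 // => k _.
  rewrite (_ : i == ev k = false) ?mul0r //.
  by apply: contraNF iI => /eqP ->; exact: ev_in.
rewrite (bigD1 k) //= big1 ?addr0 => [|l lk]; last first.
  rewrite (_ : ev k == ev l = false) ?mul0r //.
  by apply: contraNF lk => /eqP/enum_val_inj ->.
rewrite eqxx mul1r; have /matrixP/(_ k j) := z; rewrite mxE [RHS]mxE.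
under eq_bigr do rewrite mxE.
rewrite compression_sum // => e.
have {e} -> : (L *m D0) (ev k) j = - (hh k / h (ev k)) * \sum_(i | i \notin I) C i k * (L *m D0) i j.
  move/eqP: e; rewrite addr_eq0 => /eqP e.
  rewrite mulNr -mulrN -e; field; by rewrite h_neq0 hh_neq0.
have -> : \sum_(i | i \notin I) C i k * (L *m D0) i j = (j \notin I)%:R * C j k.
  rewrite big_mkcond (bigD1 j) //= big1 ?addr0 => [|l lj].
    case: ifP => jI; last by rewrite mul0r.
    by rewrite (laplacian_green rateQ irrQ statQ revQ I_gt0) // eqxx mulr1 mul1r.
  by case: ifP => // lI; rewrite (laplacian_green rateQ irrQ statQ revQ I_gt0) // (negbTE lj) mulr0.
have [/ev_surj[l ->]|jI] := boolP (j \in I); last first.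
  rewrite (_ : ev k == j = false) ?sub0r ?mul1r ?mulNr //.
  by apply: contraNF jI => /eqP <-; exact: ev_in.
rewrite mul0r mulr0 compression_I (inj_eq enum_val_inj) [l == k]eq_sym.
case: eqVneq => [->|_]; last by rewrite mul0r mulr0 subrr.
by rewrite mul1r mulrA divfK // divff // subrr.
Qed.

(** The weights [hh j ^+ 2] make [|w|^2] the [mu]-average of the second moments of [f] at the first
    hit, and [|C w|^2] that of the squared means. *)
Lemma compression_defect_quad (w : 'cV[R]_#|I|) :
  forall f u, f = (fun j => w j 0 / hh j) -> u = (fun i => \sum_j ct j i * f j) ->
  (w^T *m N *m w) 0 0 = \sum_i mu 0 i * \sum_j Ct i j * (f j - u i) ^+ 2.
Proof.
move=> f u fE uE.
have {}fE j : f j = w j 0 / hh j by rewrite fE.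
have {}uE i : u i = \sum_j ct j i * f j by rewrite uE.
have Cw i : (C *m w) i 0 = h i * u i.
  rewrite mxE uE mulr_sumr; apply: eq_bigr => j _.
  by rewrite compressionE /ct fE; field; rewrite hh_neq0.
have -> : (w^T *m N *m w) 0 0 = sqn w - sqn (C *m w).
  rewrite (sqn_mulmx C w) /N; move: (C^T *m C) => M.
  by rewrite mulmxBr mulmxBl mulmx1 mxE [X in _ + X]mxE.
rewrite !sqnE.
have -> : \sum_i (C *m w) i 0 ^+ 2 = \sum_i mu 0 i * u i ^+ 2.
  by apply: eq_bigr => i _; rewrite Cw exprMn (sqrt_mu_sqr statQ).
have -> : \sum_j w j 0 ^+ 2 = \sum_i mu 0 i * \sum_j Ct i j * f j ^+ 2.
  under [RHS]eq_bigr do rewrite mulr_sumr.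
  rewrite exchange_big; apply: eq_bigr => j _ /=.
  under eq_bigr do rewrite mulrA.
  by rewrite -mulr_suml -weight_sqr fE; field; rewrite hh_neq0.
rewrite -sumrB; apply: eq_bigr => i _; rewrite -mulrBr; congr (_ * _).
have -> : \sum_j Ct i j * (f j - u i) ^+ 2 =
   \sum_j Ct i j * f j ^+ 2 - 2 * u i * (\sum_j ct j i * f j) + (\sum_j Ct i j) * u i ^+ 2.
  rewrite mulr_sumr mulr_suml -sumrN -!big_split /=; apply: eq_bigr => j _.
  by rewrite /ct; ring.
by rewrite committor_row_sum uE; ring.
Qed.

Lemma compression_defect_psd : psd N.
Proof.
split=> [|w].
  by rewrite /N [LHS]linearB /= trmx1 trmx_mul trmxK.
rewrite (compression_defect_quad erefl erefl) sumr_ge0 // => i _.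
rewrite mulr_ge0 ?(ltW (mu_gt0 statQ _)) // sumr_ge0 // => j _.
by rewrite mulr_ge0 ?sqr_ge0.
Qed.

Lemma compression_defect_le (w : 'cV[R]_#|I|) :
  (w^T *m N *m w) 0 0 <= \tr D0 * (w^T *m Lh *m w) 0 0.
Proof.
pose f j := w j 0 / hh j; pose u i := \sum_j ct j i * f j.
have -> : (w^T *m Lh *m w) 0 0 = E u u.
  have -> : w^T *m Lh *m w = (C *m w)^T *m L *m (C *m w) by rewrite trmx_mul /Lh !mulmxA.
  rewrite (laplacian_quad statQ); congr (dirichlet Q mu); apply/funext => i;
  rewrite mxE /u mulr_suml; apply: eq_bigr => j _;
  by rewrite compressionE /ct /f -/(h i); field; rewrite hh_neq0 h_neq0.
rewrite (compression_defect_quad (f := f) (u := u)) // mulr_suml; apply: ler_sum => i _.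
have [/ev_surj[k ->]|iI] := boolP (i \in I); last exact: variance_le_energy.
rewrite big1 ?mulr0 => [|j _].
  rewrite mulr_ge0 ?green_diag_ge0 //.
  exact: (dirichlet_ge0 rateQ statQ revQ).
rewrite Ct_I; case: eqVneq => [<-|_]; last by rewrite mul0r.
suff -> : u (ev k) = f k by rewrite subrr expr0n mulr0.
rewrite /u (bigD1 k) //= big1 => [|l lk]; last by rewrite /ct Ct_I eq_sym (negbTE lk) mul0r.
by rewrite /ct Ct_I eqxx mul1r addr0.
Qed.

(** [C] maps the vector [hh] to [h], which [L] kills. *)
Lemma compressed_singular : Lh *m \col_j hh j = 0.
Proof.
have Cw : C *m \col_j hh j = \col_i h i.
  apply/colP => i; rewrite !mxE -[RHS]mulr1 -(committor_row_sum i) mulr_sumr.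
  by apply: eq_bigr => j _; rewrite compressionE mxE; field; rewrite hh_neq0.
rewrite /Lh -mulmxA Cw -mulmxA.
suff -> : L *m \col_i h i = 0 by rewrite mulmx0.
apply/colP => i; rewrite (laplacian_mulE statQ) [RHS]mxE.
rewrite (_ : (fun k => _) = fun=> 1) ?(generator_const rateQ) ?mulr0 //.
by apply/funext => k; rewrite mxE divff // h_neq0.
Qed.

End Harmonic.

(** * The Nystrom error *)

Section Nystrom.
Variables (R : realType) (n : nat) (Q : 'M[R]_n) (mu : 'rV[R]_n).
Hypothesis rateQ : is_rate_matrix Q.
Hypothesis irrQ : irreducible_rates Q.
Hypothesis statQ : is_stationary Q mu.
Hypothesis revQ : is_reversible Q mu.
Variable I : {set 'I_n}.
Hypothesis I_gt0 : (0 < #|I|)%N.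
Let L := laplacian Q mu.
Let D0 := green Q mu I.
Let ev : 'I_#|I| -> 'I_n := enum_val.

Lemma definite_unit k (A : 'M[R]_k) : 
  (forall v : 'cV[R]_k, v != 0 -> 0 < (v^T *m A *m v) 0 0) -> A \in unitmx.
Proof.
move=> A0; rewrite -row_free_unit -kermx_eq0; apply/rowV0P => u /sub_kermxP uA.
apply/eqP/negPn/negP => u0; have := A0 u^T.
by rewrite trmx_eq0 trmxK uA mul0mx mxE ltxx => /(_ u0).
Qed.

Lemma shifted_quad (g : R) (v : 'cV[R]_n) :
  (v^T *m (L + g%:M) *m v) 0 0 = (v^T *m L *m v) 0 0 + g * sqn v.
Proof. by rewrite mulmxDr mulmxDl mul_mx_scalar -scalemxAl [LHS]mxE [X in _ + X]mxE. Qed.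

Lemma shifted_gt0 (g : R) (v : 'cV[R]_n) : 0 < g -> v != 0 ->
  0 < (v^T *m (L + g%:M) *m v) 0 0.
Proof.
move=> g0 v0; rewrite shifted_quad ltr_wpDl //.
  by have [_] := laplacian_psd rateQ statQ revQ; apply.
by rewrite mulr_gt0 // lt_neqAle sqn_ge0 andbT eq_sym mulmxT_eq0.
Qed.

Lemma nystrom_residual_unique (g : R) (X : 'M[R]_n) : 0 < g ->
  (forall i j, i \in I -> X i j = 0) ->
  (forall i j, i \notin I -> ((L + g%:M) *m X) i j = 0) -> X = 0.
Proof.
move=> g0 XI XJ; apply/matrixP => i j; rewrite [RHS]mxE.
suff : col j X = 0 by move/colP/(_ i); rewrite !mxE.
apply/eqP/negPn/negP => /(shifted_gt0 g0); rewrite quadE big1 ?ltxx // => k _.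
have -> : (L + g%:M) *m col j X = col j ((L + g%:M) *m X) by rewrite !colE mulmxA.
rewrite [(col j X) k 0]mxE [(col j _) k 0]mxE.
by have [kI|kI] := boolP (k \in I); [rewrite XI // mul0r|rewrite XJ // mulr0].
Qed.

(* The hypotheses say that [Dg = D0 (1 + g D0)^-1]. *)
Lemma nystrom_residual_green (g : R) (Dg : 'M[R]_n) : 0 < g ->
  (1%:M + g *: D0) *m Dg = D0 -> D0 *m Dg = Dg *m D0 ->
  nystrom_residual (shifted_inverse L g) I = Dg.
Proof.
move=> g0 DgE DgC; pose Lg := L + g%:M; pose K := invmx Lg.
have Lgu : Lg \in unitmx by apply: definite_unit => v; exact: shifted_gt0.
have LgT : Lg^T = Lg.
  by rewrite /Lg [LHS]linearD /= tr_scalar_mx (laplacian_sym statQ revQ).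
have KT : K^T = K by rewrite /K trmx_inv LgT.
have Kgt0 (v : 'cV[R]_n) : v != 0 -> 0 < (v^T *m K *m v) 0 0.
  move=> v0; have -> : v^T *m K *m v = (K *m v)^T *m Lg *m (K *m v).
    by rewrite trmx_mul KT -!mulmxA mulKVmx.
  apply: shifted_gt0 => //; apply: contra v0 => /eqP Kv.
  by rewrite -[v](mulKVmx Lgu) -/K Kv mulmx0.
pose E : 'M[R]_(n, #|I|) := \matrix_(i, k) (i == ev k)%:R.
have colE m (A : 'M[R]_(m, n)) : colsub ev A = A *m E.
  apply/matrixP => i k; rewrite !mxE (bigD1 (ev k)) //= big1 => [|j jk].
    by rewrite mxE eqxx mulr1 addr0.
  by rewrite mxE (negbTE jk) mulr0.
have rowE m (A : 'M[R]_(n, m)) : rowsub ev A = E^T *m A.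
  apply/matrixP => k j; rewrite !mxE (bigD1 (ev k)) //= big1 => [|i ik].
    by rewrite !mxE eqxx mul1r addr0.
  by rewrite !mxE (negbTE ik) mul0r.
have subE (A : 'M[R]_n) : mxsub ev ev A = E^T *m A *m E.
  by rewrite -rowE -colE; apply/matrixP => i k; rewrite !mxE.
have EE : E^T *m E = 1%:M.
  by rewrite -rowE; apply/matrixP => i k; rewrite !mxE (inj_eq enum_val_inj).
have Ku : E^T *m K *m E \in unitmx.
  apply: definite_unit => v v0.
  have -> : v^T *m (E^T *m K *m E) *m v = (E *m v)^T *m K *m (E *m v).
    by rewrite trmx_mul !mulmxA.
  apply: Kgt0; apply: contra v0 => /eqP Ev.
  by rewrite -[v]mul1mx -EE -mulmxA Ev mulmx0.
rewrite /nystrom_residual /shifted_inverse -/Lg -/K -/ev subE colE rowE.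
set X := K - _; apply/eqP; rewrite -subr_eq0; apply/eqP.
have DI i j : i \in I -> Dg i j = 0.
  move=> iI; have -> : Dg = D0 - g *: (D0 *m Dg).
    by rewrite -[in X in X - _]DgE mulmxDl mul1mx -scalemxAl addrK.
  rewrite mxE [X in _ + X]mxE [X in _ - X]mxE [(D0 *m Dg) i j]mxE big1 => [|k _].
    by rewrite mulr0 subr0 (green_I rateQ irrQ statQ revQ I_gt0).
  by rewrite (green_I rateQ irrQ statQ revQ I_gt0) // mul0r.
(* Both matrices vanish on the rows in [I], and [L + g] maps both to identity rows off [I]. *)
apply: (nystrom_residual_unique g0) => [i j iI|i j iI].
  rewrite mxE [(- Dg) i j]mxE DI // subr0.
  have -> : i = ev (enum_rank_in iI i) by rewrite /ev enum_rankK_in.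
  have : E^T *m X = 0.
    by rewrite /X mulmxBr !mulmxA mulmxV // mul1mx subrr.
  by rewrite -rowE => /matrixP/(_ (enum_rank_in iI i) j); rewrite !mxE.
have XE : Lg *m X = 1%:M - E *m (invmx (E^T *m K *m E) *m (E^T *m K)).
  by rewrite /X mulmxBr !mulmxA mulmxV // mul1mx.
have LDg : (Lg *m Dg) i j = (i == j)%:R.
  have -> : Dg = D0 *m (1%:M - g *: Dg).
    rewrite mulmxBr mulmx1 -scalemxAr -[in X in X - _]DgE mulmxDl mul1mx.
    by rewrite -scalemxAl addrK.
  rewrite mulmxA /Lg mulmxDl mul_scalar_mx mulmxDl mxE.
  have r1 : (L *m D0 *m (1%:M - g *: Dg)) i j = (1%:M - g *: Dg) i j.
    rewrite mxE (bigD1 i) //= big1 => [|k ki].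
      by rewrite (laplacian_green rateQ irrQ statQ revQ I_gt0) // eqxx mul1r addr0.
    by rewrite (laplacian_green rateQ irrQ statQ revQ I_gt0) // eq_sym (negbTE ki) mul0r.
  rewrite r1 -scalemxAl.
  have -> : D0 *m (1%:M - g *: Dg) = Dg.
    rewrite mulmxBr mulmx1 -scalemxAr -[in X in X - _]DgE mulmxDl mul1mx.
    by rewrite -scalemxAl addrK.
  by rewrite !mxE subrK.
rewrite mulmxBr mxE [X in _ + X]mxE LDg XE mxE [X in _ + X - _]mxE mxE.
rewrite mxE big1 => [|k _]; first by rewrite subr0 subrr.
rewrite mxE (_ : i == ev k = false) ?mul0r //.
by apply: contraNF iI => /eqP ->; exact: enum_valP.
Qed.

(** For [g > 0] the residual has the eigenvalues [l / (1 + g l) >= 0], so its nuclear norm is their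
    sum, continuous at [g = 0]. *)
Lemma nystrom_errorE : nystrom_error L I = \tr D0.
Proof.
have D0psd : psd D0 := green_psd rateQ irrQ statQ revQ I_gt0.
have [W WW [l D0E]] := symmetric_diagonalization (green_sym rateQ irrQ statQ revQ I_gt0).
have WW' : W *m W^T = 1%:M by exact: mulmx1C.
have l0 i : 0 <= l 0 i by apply: (psd_eigenvalue_ge0 i WW'); rewrite -D0E.
have conjM (a b : 'rV[R]_n) : (W^T *m diag_mx a *m W) *m (W^T *m diag_mx b *m W) =
    W^T *m diag_mx (\row_i (a 0 i * b 0 i)) *m W.
  rewrite !mulmxA -(mulmxA _ W) WW' mulmx1 -(mulmxA W^T (diag_mx a)); congr (_ *m _ *m _).
  apply/matrixP => i j; rewrite mul_diag_mx !mxE.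
  by case: eqP => [->|_]; rewrite ?mulr1n ?mulr0n ?mulr0.
have res g : 0 < g -> nuclear_norm (nystrom_residual (shifted_inverse L g) I) =
    \sum_i l 0 i / (1 + g * l 0 i).
  move=> g0; have lg i : 0 < 1 + g * l 0 i by rewrite ltr_pwDl // mulr_ge0 // ltW.
  pose lg' := \row_i (l 0 i / (1 + g * l 0 i)).
  rewrite (@nystrom_residual_green g (W^T *m diag_mx lg' *m W)) //.
  - rewrite (nuclear_norm_diag WW erefl); apply: eq_bigr => i _.
    by rewrite mxE ger0_norm // divr_ge0 // ltW.
  - rewrite mulmxDl mul1mx -scalemxAl /D0 D0E conjM scalemxAl scalemxAr -mulmxDl -mulmxDr.
    congr (_ *m _ *m _); apply/matrixP => i j; rewrite !mxE.
    case: eqP => [->|_]; rewrite ?mulr1n ?mulr0n ?mulr0 ?addr0 //.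
    by field; rewrite gt_eqF.
  - rewrite /D0 D0E !conjM; congr (_ *m diag_mx _ *m _).
    by apply/rowP => i; rewrite !mxE mulrC.
have trE : \tr D0 = \sum_i l 0 i.
  by rewrite /D0 D0E mxtrace_mulC mulmxA WW' mul1mx mxtrace_diag.
rewrite /nystrom_error trE; apply: cvg_lim => //.
have : (fun g => \sum_i l 0 i / (1 + g * l 0 i)) @ 0^'+ --> \sum_i l 0 i.
  apply: cvg_at_right_filter.
  apply: cvg_big => [|i _]; first exact: add_continuous.
  rewrite -[X in _ --> X]mulr1; apply: cvgM; first exact: cvg_cst.
  rewrite -[X in _ --> X]invr1; apply: cvgV; first exact: oner_neq0.
  have : 1 + g * l 0 i @[g --> (0 : R)] --> 1 + 0 * l 0 i.
    by apply: cvgD; [exact: cvg_cst|apply: cvgM; [exact: cvg_id|exact: cvg_cst]].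
  by rewrite mul0r addr0.
apply: cvg_trans; apply: near_eq_cvg; near=> g.
by rewrite res //; near: g; exact: nbhs_right_gt.
Unshelve. all: by end_near. Qed.

End Nystrom.

(** * First hits along a time grid *)

Section Measure.
Variables (R : realType) (d : measure_display) (T : measurableType d).
Variable (P : probability T R).

(** [B] is the lower limit of the [A k]. This is how the hitting events, defined by uncountably many
    times, become measurable. *)
Lemma eventually_eq_measurable (A : (set T)^nat) (B : set T) :
  (forall k, measurable (A k)) ->
  (forall w, \forall k \near \oo, A k w <-> B w) -> measurable B.
Proof.
move=> mA AB; have -> : B = \bigcup_m \bigcap_(k in [set k | (m <= k)%N]) A k.
  apply/seteqP; split=> w.
    move=> Bw; have [N _ hN] := AB w; exists N => // k /= Nk.
    by apply/(hN k Nk).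
  move=> [m _ hm]; have [N _ hN] := AB w.
  apply/(hN (maxn m N)) => /=; first exact: leq_maxr.
  by apply: hm => /=; exact: leq_maxl.
apply: bigcupT_measurable => m; apply: bigcap_measurable => //.
by exists m => /=.
Qed.

(** Squeeze [A k] between the tail intersection [E k] and the tail union [F k], which are monotone
    with common limit [B]. *)
Lemma cvg_eventually_eq (A : (set T)^nat) (B : set T) :
  (forall k, measurable (A k)) ->
  (forall w, \forall k \near \oo, A k w <-> B w) ->
  fine (P (A k)) @[k --> \oo] --> fine (P B).
Proof.
move=> mA AB; have mB := eventually_eq_measurable mA AB.
pose E m := \bigcap_(k in [set k | (m <= k)%N]) A k.
pose F m := \bigcup_(k in [set k | (m <= k)%N]) A k.
have mE m : measurable (E m).
  by apply: bigcap_measurable => //; exists m => /=.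
have mF m : measurable (F m) by apply: bigcup_measurable.
have EB : \bigcup_m E m = B.
  apply/seteqP; split=> w.
    move=> [m _ hm]; have [N _ hN] := AB w.
    apply/(hN (maxn m N)) => /=; first exact: leq_maxr.
    by apply: hm => /=; exact: leq_maxl.
  move=> Bw; have [N _ hN] := AB w; exists N => // k /= Nk.
  by apply/(hN k Nk).
have FB : \bigcap_m F m = B.
  apply/seteqP; split=> w.
    move=> Fw; have [N _ hN] := AB w; have [k /= Nk Ak] := Fw N I.
    by apply/(hN k Nk).
  move=> Bw m _; have [N _ hN] := AB w; exists (maxn m N) => /=; first exact: leq_maxl.
  by apply/(hN (maxn m N)) => //=; exact: leq_maxr.
have cE : P (E m) @[m --> \oo] --> P B.
  rewrite -EB; apply: nondecreasing_cvg_mu => //; first exact: bigcupT_measurable.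
  move=> a b ab; rewrite subsetEset => w Ew k /= bk; apply: Ew => /=.
  exact: leq_trans bk.
have cF : P (F m) @[m --> \oo] --> P B.
  rewrite -FB; apply: nonincreasing_cvg_mu => //.
  - by rewrite ltey_eq fin_num_measure.
  - exact: bigcapT_measurable.
  - move=> a b ab; rewrite subsetEset => w [k /= bk Ak]; exists k => //=.
    exact: leq_trans bk.
have cA : P (A k) @[k --> \oo] --> P B.
  apply: (squeeze_cvge _ cE cF); apply: nearW => k; apply/andP; split.
    by apply: le_measure; rewrite ?inE // => w; apply => /=.
  by apply: le_measure; rewrite ?inE // => w Aw; exists k => /=.
by apply: fine_cvg; rewrite fineK // fin_num_measure.
Qed.

Lemma measure_ffun_partition n (Y : T -> 'I_n) (A : set T) : measurable A ->
  (forall a, measurable [set w | Y w = a]) ->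
  P A = (\sum_(a < n) P (A `&` [set w | Y w = a]))%E.
Proof.
move=> mA mY; rewrite -measure_bigsetU_ord //.
- congr (P _); apply/seteqP; split=> w; rewrite -bigcup_seq.
    by move=> Aw; exists (Y w) => //=; rewrite mem_index_enum.
  by move=> [a _ []].
- by move=> a; exact: measurableI.
- by move=> a b _ _ [w [[_ /= <-] [_ /= ->]]].
Qed.

End Measure.

Section Skeleton.
Variables (R : realType) (n : nat) (d : measure_display) (T : measurableType d).
Variables (P : probability T R) (X : R -> T -> 'I_n) (Q : 'M[R]_n).
Hypothesis chainX : is_markov_chain P X Q.
Variables (I : {set 'I_n}) (j : 'I_n) (dt : R).
Hypothesis jI : j \in I.
Hypothesis dt_gt0 : 0 < dt.

Let M := expm (dt *: Q).
Let time (k : nat) : R := k%:R * dt.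

Let time_ge0 k : 0 <= time k.
Proof. by rewrite mulr_ge0 // ltW. Qed.

(* Probability that the chain on the grid, started at [i], enters [I] for the
   first time at step [k], and there at [j] *)
Fixpoint first_hit_prob (k : nat) (i : 'I_n) : R :=
  if k is k'.+1 then
    if i \in I then 0 else \sum_l M i l * first_hit_prob k' l
  else (i == j)%:R.

Definition grid_path (p : nat) (i : nat -> 'I_n) : set T :=
  [set w | forall l, (l <= p)%N -> X (time l) w = i l].

Definition grid_first_hit (p k : nat) : set T :=
  [set w | (forall l, (l < k)%N -> X (time (p + l)) w \notin I) /\ X (time (p + k)) w = j].

Lemma measurable_state (t : R) (S : {set 'I_n}) : 0 <= t -> measurable [set w | X t w \in S].
Proof.
move=> t0; have [mX _ _] := chainX.
have -> : [set w | X t w \in S] = \bigcup_(a in [set` S]) [set w | X t w = a].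
  by apply/seteqP; split=> w /=; [exists (X t w)|move=> [a aS /= ->]].
by apply: fin_bigcup_measurable => // a _; exact: mX.
Qed.

Lemma measurable_grid_path p i : measurable (grid_path p i).
Proof.
have [mX _ _] := chainX.
have -> : grid_path p i = \bigcap_(l in [set l | (l <= p)%N]) [set w | X (time l) w = i l].
  by [].
by apply: bigcap_measurable; [exists 0%N|move=> l _; exact: mX].
Qed.

Lemma measurable_grid_first_hit p k : measurable (grid_first_hit p k).
Proof.
have [mX _ _] := chainX.
have -> : grid_first_hit p k = \bigcap_l
    (if (l < k)%N then [set w | X (time (p + l)) w \in ~: I] else setT) `&`
    [set w | X (time (p + k)) w = j].
  apply/seteqP; split=> w.
    move=> [h hj]; split=> // l _; case: ifP => //= lk.
    by rewrite finset.in_setC h.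
  move=> [h hj]; split=> // l lk.
  by have := h l Logic.I; rewrite lk /= finset.in_setC.
apply: measurableI; last exact: mX.
apply: bigcapT_measurable => l; case: ifP => // _; exact: measurable_state.
Qed.

Lemma grid_path_step p i :
  P (grid_path p.+1 i) = (P (grid_path p i) * (M (i p) (i p.+1))%:E)%E.
Proof.
have [_ _ /(_ p time i)] := chainX.
rewrite (_ : time p.+1 - time p = dt); last by rewrite /time -natr1; ring.
apply; first exact: time_ge0.
by move=> l _; rewrite /time ler_wpM2r ?ler_nat ?(ltW dt_gt0).
Qed.

(** First-step analysis by induction on [k]. The past path is arbitrary because each step appends
    the next state to it, as [ia] does below. *)
Lemma grid_first_hit_prob k p i :
  P (grid_path p i `&` grid_first_hit p k) = (P (grid_path p i) * (first_hit_prob k (i p))%:E)%E.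
Proof.
elim: k p i => [|k IHk] p i /=.
  have [ij|ij] := eqVneq (i p) j.
    rewrite mule1; congr (P _); apply/seteqP; split=> w; first by case.
    by move=> hw; split=> //; split=> //; rewrite addn0 hw.
  rewrite mule0 (_ : _ `&` _ = set0) ?measure0 //.
  apply/seteqP; split=> // w [hw [_]]; rewrite addn0 hw // => e.
  by rewrite e eqxx in ij.
have [ipI|ipI] := boolP (i p \in I).
  rewrite mule0 (_ : _ `&` _ = set0) ?measure0 //.
  apply/seteqP; split=> // w [hw [/(_ 0%N isT)]].
  by rewrite addn0 hw // ipI.
have [mX _ _] := chainX.
rewrite (@measure_ffun_partition _ _ _ P _ (X (time p.+1))); last first.
- by move=> a; exact: mX.
- by apply: measurableI; [exact: measurable_grid_path|exact: measurable_grid_first_hit].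
pose ia a l := if (l <= p)%N then i l else a.
have e a : P (grid_path p i `&` grid_first_hit p k.+1 `&` [set w | X (time p.+1) w = a]) =
    (P (grid_path p i) * (M (i p) a * first_hit_prob k a)%:E)%E.
  have -> : grid_path p i `&` grid_first_hit p k.+1 `&` [set w | X (time p.+1) w = a] =
      grid_path p.+1 (ia a) `&` grid_first_hit p.+1 k.
    apply/seteqP; split=> w.
      move=> [[hw [hI hj]] /= ha]; split; [|split].
      - move=> l; rewrite leq_eqVlt => /predU1P[->|lp].
          by rewrite /ia ltnn.
        by rewrite /ia -ltnS lp hw.
      - by move=> l lk; rewrite addSnnS; apply: hI.
      - by rewrite addSnnS.
    move=> [hw [hI hj]]; split; [split|].
    - move=> l lp; rewrite hw; last exact: leqW.
      by rewrite /ia lp.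
    - split; last by rewrite -addSnnS.
      move=> [_|l lk]; first by rewrite addn0 hw // /ia leqnn.
      by rewrite -addSnnS hI.
    - by rewrite /= hw // /ia ltnn.
  rewrite IHk grid_path_step /ia ltnn leqnn -muleA -EFinM; congr (P _ * _)%E.
  apply/seteqP; split=> w hw l lp; have := hw l lp; by rewrite lp.
rewrite (eq_bigr _ (fun a _ => e a)).
have fp : P (grid_path p i) \is a fin_num.
  by rewrite fin_num_measure //; exact: measurable_grid_path.
rewrite -(fineK fp) -EFinM mulr_sumr -sumEFin.
by apply: eq_bigr => a _; rewrite -EFinM.
Qed.

Definition grid_hit : set T := \bigcup_k grid_first_hit 0 k.

Lemma grid_first_hit_inj w k k' p : grid_first_hit p k w -> grid_first_hit p k' w -> k = k'.
Proof.
move=> [h hj] [h' hj']; apply/eqP; rewrite eqn_leq; apply/andP; split; rewrite leqNgt; apply/negP.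
  by move=> /h; rewrite hj' jI.
by move=> /h'; rewrite hj jI.
Qed.

Lemma measurable_grid_hit : measurable grid_hit.
Proof. by apply: bigcupT_measurable => k; exact: measurable_grid_first_hit. Qed.

Let start i := [set w | X 0 w = i].

Let mstart i : measurable (start i).
Proof. by have [mX _ _] := chainX; exact: mX. Qed.

Hypothesis startX : forall i, (0 < P (start i))%E.

Lemma fine_start_gt0 i : 0 < fine (P (start i)).
Proof. by rewrite fine_gt0 // startX /= ltey_eq fin_num_measure. Qed.

Definition grid_committor i := fine (P (grid_hit `&` start i)) / fine (P (start i)).

Lemma cvg_grid_committor i :
  \sum_(k < K) first_hit_prob k i @[K --> \oo] --> grid_committor i.
Proof.
pose F k := grid_first_hit 0 k `&` start i.
have mF k : measurable (F k) by apply: measurableI => //; exact: measurable_grid_first_hit.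
have tF : trivIset setT F.
  by move=> a b _ _ [w [[ha _] [hb _]]]; exact: grid_first_hit_inj ha hb.
have PF k : P (F k) = (P (start i) * (first_hit_prob k i)%:E)%E.
  have -> : start i = grid_path 0 (fun=> i).
    apply/seteqP; split=> w; first by move=> wi l; rewrite leqn0 => /eqP ->; rewrite /time mul0r.
    by move=> /(_ 0%N isT); rewrite /time mul0r.
  by rewrite /F setIC -grid_first_hit_prob; congr (P (_ `&` _)); apply/seteqP; split=> w;
   [move=> wi l; rewrite leqn0 => /eqP ->; rewrite /time mul0r|move=> /(_ 0%N isT); rewrite /time mul0r].
have h := @cvg_eventually_eq _ _ _ P (fun K => \big[setU/set0]_(k < K) F k) (grid_hit `&` start i).
have e K : fine (P (\big[setU/set0]_(k < K) F k)) = fine (P (start i)) * \sum_(k < K) first_hit_prob k i.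
  rewrite measure_bigsetU //.
  rewrite (eq_bigr _ (fun (k : 'I_K) _ => PF k)).
  rewrite -{1}(fineK (fin_num_measure P _ (mstart i))) mulr_sumr.
  rewrite (eq_bigr (fun k : 'I_K => (fine (P (start i)) * first_hit_prob k i)%:E)).
    by rewrite sumEFin.
  by move=> k _; rewrite EFinM.
have s0 := fine_start_gt0 i.
have -> : (fun K => \sum_(k < K) first_hit_prob k i) =
    (fun K => (fine (P (start i)))^-1 * fine (P (\big[setU/set0]_(k < K) F k))).
  by apply/funext => K; rewrite e mulKf // gt_eqF.
rewrite /grid_committor mulrC; apply: cvgM; first exact: cvg_cst.
apply: h => [K|w]; first exact: bigsetU_measurable.
have [[[k _ hk] wi]|hw] := pselect ((grid_hit `&` start i) w).
  exists k.+1 => // K /= kK; split=> _; first by split=> //; exists k.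
  by rewrite -(bigcup_mkord K F); exists k.
apply: nearW => K; split=> //; rewrite -(bigcup_mkord K F) => -[k _ [hk wi]].
by split=> //; exists k.
Qed.

(** The sums up to [K + 1] at [i] are the [M]-averages of the sums up to [K]; let [K] go to
    infinity. *)
Lemma grid_committor_harmonic i : i \notin I ->
  grid_committor i = \sum_l M i l * grid_committor l.
Proof.
move=> iI; have c1 := @cvg_grid_committor i.
have c2 : \sum_l M i l * (\sum_(k < K) first_hit_prob k l) @[K --> \oo] -->
    \sum_l M i l * grid_committor l.
  apply: cvg_big => [|l _]; first exact: add_continuous.
  by apply: cvgM; [exact: cvg_cst|exact: cvg_grid_committor].
have e K : \sum_(k < K.+1) first_hit_prob k i = \sum_l M i l * (\sum_(k < K) first_hit_prob k l).
  rewrite big_ord_recl /= (_ : i == j = false) ?add0r; last first.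
    by apply: contraNF iI => /eqP ->.
  under eq_bigr do rewrite (negbTE iI).
  by rewrite exchange_big /=; apply: eq_bigr => l _; rewrite mulr_sumr.
have : \sum_(k < K.+1) first_hit_prob k i @[K --> \oo] --> grid_committor i.
  by rewrite (cvg_shiftS (fun K => \sum_(k < K) first_hit_prob k i)).
under eq_cvg do rewrite e.
by move=> c3; apply: cvg_unique c3 c2; exact: Rhausdorff.
Qed.

End Skeleton.

(** * The committor is harmonic *)

Section SmallTime.
Variable R : realType.

Lemma cvg_expR_difference (l : R) :
  k.+1%:R * (expR (k.+1%:R^-1 * l) - 1) @[k --> \oo] --> l.
Proof.
pose a (k : nat) : R := k.+1%:R^-1.
have a0 k : 0 < a k by rewrite invr_gt0.
have ca : a k @[k --> \oo] --> (0 : R) by exact: cvg_harmonic.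
have cal : a k * l @[k --> \oo] --> (0 : R).
  by rewrite -[X in _ --> X](mul0r l); apply: cvgM => //; exact: cvg_cst.
have cinv : l / (1 - a k * l) @[k --> \oo] --> l.
  rewrite -[X in _ --> X]mulr1; apply: cvgM; first exact: cvg_cst.
  rewrite -[X in _ --> X]invr1; apply: cvgV; first exact: oner_neq0.
  have : 1 - a k * l @[k --> \oo] --> (1 - 0 : R).
    by apply: cvgB => //; exact: cvg_cst.
  by rewrite subr0.
(* Both bounds come from [1 + z <= exp z], at [z = a k * l] and at its opposite. *)
apply: (squeeze_cvgr _ (cvg_cst l) cinv); near=> k.
have small : a k * l < 1 by near: k; exact: (cvgr_lt _ cal).
have pos : 0 < 1 - a k * l by rewrite subr_gt0.
have k0 : k.+1%:R != 0 :> R by rewrite pnatr_eq0.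
have lE : l = k.+1%:R * (a k * l) by rewrite mulrA divff // mul1r.
rewrite -/(a k); apply/andP; split.
  rewrite {1}lE ler_wpM2l // lerBrDl; exact: expR_ge1Dx.
have -> : l / (1 - a k * l) = k.+1%:R * (a k * l / (1 - a k * l)) by rewrite [RHS]mulrA -lE.
rewrite ler_wpM2l // lerBlDr.
have -> : a k * l / (1 - a k * l) + 1 = (1 - a k * l)^-1 by field; rewrite gt_eqF.
rewrite -[leLHS]invrK -expRN lef_pV2 ?posrE ?expR_gt0 //.
exact: expR_ge1Dx.
Unshelve. all: by end_near. Qed.

Lemma cvg_expm_difference n (V W Q : 'M[R]_n) (l : 'rV[R]_n) i j :
  V *m W = 1%:M -> Q = V *m diag_mx l *m W ->
  k.+1%:R * (expm (k.+1%:R^-1 *: Q) i j - (i == j)%:R) @[k --> \oo] --> Q i j.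
Proof.
move=> VW QE.
have -> : Q i j = \sum_a V i a * W a j * l 0 a.
  rewrite QE mxE; apply: eq_bigr => a _; rewrite mul_mx_diag mxE; ring.
have -> : (fun k => k.+1%:R * (expm (k.+1%:R^-1 *: Q) i j - (i == j)%:R)) =
    (fun k => \sum_a V i a * W a j * (k.+1%:R * (expR (k.+1%:R^-1 * l 0 a) - 1))).
  apply/funext => k.
  have -> : expm (k.+1%:R^-1 *: Q) = V *m diag_mx (map_mx expR (k.+1%:R^-1 *: l)) *m W.
    by apply: expm_diag VW _; rewrite QE linearZ /= -scalemxAr -scalemxAl.
  have <- : (V *m W) i j = (i == j)%:R by rewrite VW mxE.
  rewrite [(V *m W) i j]mxE mxE -sumrB mulr_sumr; apply: eq_bigr => a _.
  by rewrite mul_mx_diag !mxE; ring.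
apply: cvg_big => [|a _]; first exact: add_continuous.
by apply: cvgM; [exact: cvg_cst|exact: cvg_expR_difference].
Qed.

End SmallTime.

Section Hitting.
Variables (R : realType) (n : nat) (d : measure_display) (T : measurableType d).
Variables (P : probability T R) (X : R -> T -> 'I_n) (Q : 'M[R]_n).
Hypothesis chainX : is_markov_chain P X Q.
Variable I : {set 'I_n}.

Lemma right_constant w (t : R) : 0 <= t ->
  exists2 e : R, 0 < e & forall s, t <= s < t + e -> X s w = X t w.
Proof.
have [_ rX _] := chainX; move=> t0.
have [e /= e0 he] := rX w t t0; exists e => // s /andP[].
rewrite le_eqVlt => /predU1P[->//|ts] se.
apply: he => //=; rewrite distrC gtr0_norm ?subr_gt0 //; lra.
Qed.

(** The infimum of the hitting set is attained because paths are constant just to the right of each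
    time. *)
Lemma hitting_time_exists w (s : R) : 0 <= s -> X s w \in I ->
  exists t, is_hitting_time X I w t.
Proof.
move=> s0 sI; pose A := [set s | 0 <= s /\ X s w \in I].
have lA : lbound A 0 by move=> a [].
have hA : has_inf A by split; [exists s|exists 0].
have t0 : 0 <= inf A by apply: lb_le_inf => //; exists s.
have inf_le a : 0 <= a -> X a w \in I -> inf A <= a.
  by move=> a0 aI; apply: ge_inf => //; exists 0.
exists (inf A); split=> //.
have [e e0 he] := right_constant w t0.
have [a [a0 aI] ae] := inf_adherent e0 hA.
by rewrite -(he a) // ae andbT inf_le.
Qed.

Lemma hitting_time_unique w t t' :
  is_hitting_time X I w t -> is_hitting_time X I w t' -> t = t'.
Proof.
move=> [t0 tI tm] [t'0 t'I t'm]; apply/eqP.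
by rewrite eq_le tm // t'm.
Qed.

Lemma grid_hit_eventually w j : j \in I ->
  \forall k \near \oo, grid_hit X I j k.+1%:R^-1 w <-> hits_at X I j w.
Proof.
move=> jI.
have [[t ht]|noht] := pselect (exists t, is_hitting_time X I w t); last first.
  apply: nearW => k; split=> [[l _ [_ hl]]|[t ht _]]; last by case: noht; exists t.
  by case: noht; apply: (hitting_time_exists (s := (0 + l)%:R * k.+1%:R^-1)); rewrite ?hl ?mulr_ge0.
have [t0 tI tm] := ht; have [e e0 he] := right_constant w t0.
near=> k.
have dt_gt0 : 0 < k.+1%:R^-1 :> R by rewrite invr_gt0.
have dt_lt : k.+1%:R^-1 < e.
  near: k; have := @cvg_harmonic R => /cvgr_lt; exact.
set dt := k.+1%:R^-1 in dt_gt0 dt_lt *.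
have ex : exists l : nat, t <= l%:R * dt.
  exists (Num.truncn (t / dt)).+1; rewrite -ler_pdivrMr // ltW //.
  exact: truncnS_gt.
(* The first grid time at or after [t] lies in [[t, t + dt[], where the path still sits at [X t w];
   earlier grid times precede the hit. *)
case: (ex_minnP ex) => l tl lmin.
have ltt : l%:R * dt < t + dt.
  case: l tl lmin => [|l] tl lmin; first by rewrite mul0r ltr_wpDl.
  rewrite -natr1 mulrDl mul1r ltrD2r ltNge; apply/negP => /lmin.
  by rewrite ltnn.
have Xl : X (l%:R * dt) w = X t w.
  by apply: he; rewrite tl (lt_trans ltt) // ltrD2l.
have hit : grid_first_hit X I (X t w) dt 0 l w.
  split; last by rewrite add0n.
  move=> a al; rewrite add0n; apply/negP => aI.
  have : t <= a%:R * dt by apply: tm => //; rewrite mulr_ge0 // ltW.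
  by move=> /lmin; rewrite leqNgt al.
split.
  move=> [l' _ hl'].
  have ll' : l = l'.
    have [h1 _] := hit; have [h2 hj] := hl'.
    apply/eqP; rewrite eqn_leq; apply/andP; split; rewrite leqNgt; apply/negP.
      by move=> /h1; rewrite hj jI.
    by move=> /h2; rewrite add0n Xl tI.
  exists t => //; rewrite -Xl; have [_] := hl'.
  by rewrite -ll' add0n.
move=> [t' ht' <-]; exists l => //.
by rewrite -(hitting_time_unique ht ht').
Unshelve. all: by end_near. Qed.

Hypothesis startX : forall i, (0 < P [set w | X 0%R w = i])%E.
Variables (V W : 'M[R]_n) (l : 'rV[R]_n).
Hypothesis VW : V *m W = 1%:M.
Hypothesis QE : Q = V *m diag_mx l *m W.

Let measurable_start i : measurable [set w | X 0 w = i].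
Proof. by have [mX _ _] := chainX; exact: mX. Qed.

Lemma committor_ge0 i j : 0 <= committor P X I i j.
Proof. by rewrite mxE divr_ge0 // fine_ge0. Qed.

Lemma committor_target k j : committor P X I (enum_val k) j = (k == j)%:R.
Proof.
rewrite mxE /cond_prob.
have hit0 w : X 0 w = enum_val k -> is_hitting_time X I w 0.
  by move=> e; split=> //; rewrite e enum_valP.
have [<-|kj] := eqVneq k j.
  have -> : hits_at X I (enum_val k) `&` [set w | X 0 w = enum_val k] =
      [set w | X 0 w = enum_val k].
    apply/seteqP; split=> w; first by case.
    by move=> /= e; split=> //; exists 0 => //; exact: hit0.
  by rewrite divff // gt_eqF // (fine_start_gt0 chainX startX).
have -> : hits_at X I (enum_val j) `&` [set w | X 0 w = enum_val k] = set0.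
  apply/seteqP; split=> // w [[t ht Xt] /= e].
  have t0 := hitting_time_unique ht (hit0 w e).
  by move: kj; rewrite -(inj_eq enum_val_inj) -e -Xt t0 eqxx.
by rewrite measure0 mul0r.
Qed.

Lemma cvg_committor i j :
  grid_committor P X I (enum_val j) k.+1%:R^-1 i @[k --> \oo] --> committor P X I i j.
Proof.
rewrite mxE /cond_prob /grid_committor; apply: cvgM; last exact: cvg_cst.
apply: cvg_eventually_eq => [k|w].
  apply: measurableI => //; apply: (measurable_grid_hit chainX).
  by rewrite invr_gt0.
near=> k; have : grid_hit X I (enum_val j) k.+1%:R^-1 w <-> hits_at X I (enum_val j) w.
  by near: k; apply: grid_hit_eventually; exact: enum_valP.
by move=> h; split=> -[/h ? ?]; split.
Unshelve. all: by end_near. Qed.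

(** On the grid of step [1 / k], harmonicity says that [k (exp(Q / k) - 1)] kills the grid committor
    at [i]; both factors converge. *)
Lemma committor_harmonic i j : i \notin I -> (Q *m committor P X I) i j = 0.
Proof.
move=> iI.
pose u k a := grid_committor P X I (enum_val j) k.+1%:R^-1 a.
have c1 : \sum_a (k.+1%:R * (expm (k.+1%:R^-1 *: Q) i a - (i == a)%:R)) * u k a @[k --> \oo] -->
    \sum_a Q i a * committor P X I a j.
  apply: cvg_big => [|a _]; first exact: add_continuous.
  by apply: cvgM; [exact: cvg_expm_difference VW QE|exact: cvg_committor].
rewrite mxE; apply: (cvg_unique _ c1); first exact: Rhausdorff.
have -> : (fun k => \sum_a (k.+1%:R * (expm (k.+1%:R^-1 *: Q) i a - (i == a)%:R)) * u k a) = fun=> 0.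
  apply/funext => k.
  have dt0 : 0 < k.+1%:R^-1 :> R by rewrite invr_gt0.
  have := grid_committor_harmonic chainX (enum_valP j) dt0 startX iI; rewrite -/(u k i) => e.
  under eq_bigr do rewrite -mulrA mulrBl.
  rewrite -mulr_sumr sumrB -e (bigD1 i) //= eqxx mul1r big1 ?addr0 ?subrr ?mulr0 //.
  by move=> a ai; rewrite eq_sym (negbTE ai) mul0r.
exact: cvg_cst.
Qed.

End Hitting.

(** * The compression bound *)

Section Compression.
Variable R : realType.

Lemma psd_conj n m (N : 'M[R]_n) (B : 'M[R]_(m, n)) : psd N -> psd (B *m N *m B^T).
Proof.
move=> [NT N0]; split=> [|v]; first by rewrite !trmx_mul trmxK NT mulmxA.
have -> : v^T *m (B *m N *m B^T) *m v = (B^T *m v)^T *m N *m (B^T *m v).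
  by rewrite trmx_mul trmxK !mulmxA.
exact: N0.
Qed.

Lemma expm_symmetric n (A B : 'M[R]_n) (l : 'rV[R]_n) (t : R) : B^T *m B = 1%:M ->
  A = B^T *m diag_mx l *m B ->
  expm (- t *: A) = B^T *m diag_mx (\row_i expR (- (t * l 0 i))) *m B.
Proof.
move=> BB AE; rewrite (expm_diag (P := B^T) (Q := B) (l := - t *: l)) //; last first.
  by rewrite AE linearZ /= -scalemxAr -scalemxAl.
by congr (_ *m diag_mx _ *m _); apply/rowP => i; rewrite !mxE mulNr.
Qed.

Lemma compression_nuclear_norm_le n m (L D0 : 'M[R]_n) (C G : 'M[R]_(n, m)) (t : R) :
  let Lh := C^T *m L *m C in let N := 1%:M - C^T *m C in
  0 < t -> psd L -> psd D0 -> psd N ->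
  L *m C = G *m Lh -> L *m D0 = 1%:M - G *m C^T ->
  (forall w : 'cV[R]_m, (w^T *m N *m w) 0 0 <= \tr D0 * (w^T *m Lh *m w) 0 0) ->
  (exists2 w : 'cV[R]_m, w != 0 & Lh *m w = 0) ->
  nuclear_norm (C *m expm (- t *: Lh) *m C^T - expm (- t *: L)) <=
  \tr D0 / t * (9 / 4 * expR (- 1) + 41 / 10 * expR (- 1) ^+ 2 + (m%:R - 1) / 2).
Proof.
move=> Lh N t0 Lpsd D0psd Npsd LC LD0 N_le [w w0 Lw].
have Lhpsd : psd Lh by have := psd_conj C^T Lpsd; rewrite trmxK.
have [A AA [x LE]] := symmetric_diagonalization Lpsd.1.
have [B BB [y LhE]] := symmetric_diagonalization Lhpsd.1.
have AA' : A *m A^T = 1%:M by exact: mulmx1C.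
have BB' : B *m B^T = 1%:M by exact: mulmx1C.
have x0 i : 0 <= x 0 i by apply: (psd_eigenvalue_ge0 i AA'); rewrite -LE.
have y0 j : 0 <= y 0 j by apply: (psd_eigenvalue_ge0 j BB'); rewrite -LhE.
have eL := expm_symmetric t AA LE; have eLh := expm_symmetric t BB LhE.
set Dl := _ - _; have DlT : Dl^T = Dl.
  rewrite /Dl [LHS]linearB /= eL eLh !trmx_mul !tr_diag_mx !trmxK.
  by rewrite !mulmxA.
have [U UU ->] := nuclear_norm_trace DlT.
pose C' := A *m C *m B^T; pose G' := A *m G *m B^T.
(* The sign of [U'] accounts for [compression_trace_le] bounding the exact semigroup minus the
   compressed one. *)
pose D' := t^-1 *: (A *m D0 *m A^T); pose U' := - (A *m U *m A^T).
pose x' i := t * x 0 i; pose y' j := t * y 0 j.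
have dx : diag_mx (\row_i x' i) = t *: (A *m L *m A^T).
  rewrite LE !mulmxA AA' mul1mx -mulmxA AA' mulmx1 -[RHS]linearZ /=.
  by congr diag_mx; apply/rowP => i; rewrite !mxE.
have dy : diag_mx (\row_j y' j) = t *: (B *m Lh *m B^T).
  rewrite LhE !mulmxA BB' mul1mx -mulmxA BB' mulmx1 -[RHS]linearZ /=.
  by congr diag_mx; apply/rowP => i; rewrite !mxE.
have C'T : C'^T = B *m C^T *m A^T by rewrite /C' !trmx_mul trmxK mulmxA.
have N'E : B *m N *m B^T = 1%:M - C'^T *m C'.
  rewrite C'T /C' /N mulmxBr mulmx1 mulmxBl BB' !mulmxA -(mulmxA _ A^T A) AA.
  by rewrite mulmx1.
have N'psd := psd_conj B Npsd.
have trD' : \tr D' = \tr D0 / t.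
  by rewrite /D' mxtraceZ mxtrace_mulC mulmxA AA mul1mx mulrC.
have D'psd : psd D'.
  have [h1 h2] := psd_conj A D0psd; rewrite /D'; split; first by rewrite linearZ /= h1.
  by move=> v; rewrite -scalemxAr -scalemxAl mxE mulr_ge0 // invr_ge0 ltW.
have LC' : diag_mx (\row_i x' i) *m C' = G' *m diag_mx (\row_j y' j).
  rewrite dx dy /C' /G' -scalemxAl -scalemxAr; congr (_ *: _).
  rewrite !mulmxA -(mulmxA _ A^T A) AA mulmx1 -(mulmxA _ B^T B) BB mulmx1.
  by rewrite -(mulmxA A L C) LC -!mulmxA.
have LD' : diag_mx (\row_i x' i) *m D' = 1%:M - G' *m C'^T.
  rewrite dx /D' -scalemxAl -scalemxAr scalerA divff ?gt_eqF // scale1r.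
  rewrite !mulmxA -(mulmxA _ A^T A) AA mulmx1 -(mulmxA A L D0) LD0.
  rewrite mulmxBr mulmx1 mulmxBl AA' C'T /G' !mulmxA -(mulmxA _ B^T B) BB.
  by rewrite mulmx1.
have CLC' : C'^T *m diag_mx (\row_i x' i) *m C' = diag_mx (\row_j y' j).
  rewrite dx dy C'T /C' -scalemxAr -scalemxAl /Lh; congr (_ *: _).
  by rewrite !mulmxA -(mulmxA _ A^T A) AA mulmx1 -(mulmxA _ A^T A) AA mulmx1.
have N'_le (v : 'cV[R]_m) : (v^T *m (B *m N *m B^T) *m v) 0 0 <=
    \tr D0 / t * (v^T *m diag_mx (\row_j y' j) *m v) 0 0.
  have := N_le (B^T *m v).
  rewrite trmx_mul trmxK dy -scalemxAr -scalemxAl [X in _ -> _ <= _ * X]mxE.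
  by rewrite !mulmxA mulrA divfK // gt_eqF.
have U'U' : U'^T *m U' = 1%:M.
  rewrite /U' [(- _)^T]linearN /= mulNmx mulmxN opprK !trmx_mul trmxK.
  rewrite !mulmxA -(mulmxA _ A^T A) AA mulmx1 -(mulmxA A U^T U) UU mulmx1.
  exact: AA'.
have := compression_trace_le N'E (fun i => mulr_ge0 (ltW t0) (x0 i)) (fun j => mulr_ge0 (ltW t0) (y0 j))
  LC' LD' CLC' N'psd N'_le D'psd trD' U'U'.
have -> : \tr (U' *m (diag_mx (\row_i expR (- (t * x 0 i))) -
    C' *m diag_mx (\row_i expR (- (t * y 0 i))) *m C'^T)) = \tr (U *m Dl).
  have DlE : Dl = A^T *m (C' *m diag_mx (\row_i expR (- (t * y 0 i))) *m C'^T -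
      diag_mx (\row_i expR (- (t * x 0 i)))) *m A.
    rewrite /Dl eL eLh C'T /C' mulmxBr mulmxBl; congr (_ - _).
    by rewrite !mulmxA AA mul1mx -(mulmxA _ A^T A) AA mulmx1.
  by rewrite DlE /U' mulNmx -mulmxN opprB !mulmxA [RHS]mxtrace_mulC !mulmxA.
move=> /le_trans; apply.
have e0 : 0 <= \tr D0 / t by rewrite divr_ge0 ?(ltW t0) // psd_mxtrace_ge0.
apply: ler_wpM2l => //; rewrite lerD2l ler_wpM2r ?invr_ge0 //.
(* The null vector of [Lh] forces a zero eigenvalue, so at most [m - 1] of them count. *)
have [j0 yj0] : exists j, y 0 j = 0.
  apply: contrapT => /forallNP yn0.
  have yn0' j : y 0 j != 0 by apply/eqP.
  move/eqP: w0; apply.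
  have : diag_mx y *m (B *m w) = 0.
    have : B *m (Lh *m w) = 0 by rewrite Lw mulmx0.
    by rewrite LhE !mulmxA BB' mul1mx.
  move=> e; rewrite -[w]mul1mx -BB -mulmxA (_ : B *m w = 0) ?mulmx0 //.
  apply/colP => j; have /colP/(_ j) := e; rewrite mul_diag_mx mxE [RHS]mxE => /eqP.
  by rewrite [RHS]mxE mulf_eq0 (negbTE (yn0' j)) /= => /eqP.
rewrite lerBrDr natr1 ler_nat.
have sub : (#|[pred j | y' j != 0%R]| <= #|predC1 j0|)%N.
  apply: subset_leq_card; apply/fintype.subsetP => j; rewrite !inE /y' => yj.
  by apply: contraNneq yj => ->; rewrite yj0 mulr0.
by apply: (leq_ltn_trans sub); rewrite cardC1 card_ord ltn_predL; exact: leq_ltn_trans (leq0n _) (ltn_ord j0).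
Qed.

End Compression.

Unset Implicit Arguments.

Theorem theorem3 (R : realType) (n : nat) (Q : 'M[R]_n) (mu : 'rV[R]_n)
    (d : measure_display) (T : measurableType d) (P : probability T R)
    (X : R -> T -> 'I_n) (I : {set 'I_n}) (t : R)
    (rateQ : is_rate_matrix Q) (irrQ : irreducible_rates Q)
    (statQ : is_stationary Q mu) (revQ : is_reversible Q mu)
    (chainX : is_markov_chain P X Q)
    (startX : forall i, (0 < P [set w | X 0%R w = i])%E)
    (I_gt0 : (0 < #|I|)%N) (t_gt0 : 0 < t) :
  nuclear_norm (sp_compression P X Q mu I t - expm (- t *: laplacian Q mu)) <=
    (3 * Num.sqrt 3 / (2 * pi) + #|I|%:R * (2 / pi)) *
    (nystrom_error (laplacian Q mu) I / t).
Proof.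
have [A AA [l LE]] := symmetric_diagonalization (laplacian_sym statQ revQ).
pose h : 'rV[R]_n := map_mx Num.sqrt mu.
have h0 i : h 0 i != 0 by rewrite mxE gt_eqF ?(sqrt_mu_gt0 statQ).
have hh : diag_mx (map_mx GRing.inv h) *m diag_mx h = 1%:M.
  apply/matrixP => i j; rewrite mul_diag_mx !mxE.
  case: eqP => [->|_]; last by rewrite !mulr0n mulr0.
  by have := h0 j; rewrite mxE => hj; rewrite !mulr1n mulVf.
have VW : (diag_mx (map_mx GRing.inv h) *m A^T) *m (A *m diag_mx h) = 1%:M.
  by rewrite mulmxA -(mulmxA _ A^T A) AA mulmx1.
(* [Q] is similar to the symmetric matrix [- L], which provides the diagonalization needed for
   [expm]. *)
have QE : Q = (diag_mx (map_mx GRing.inv h) *m A^T) *m diag_mx (- l) *m (A *m diag_mx h).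
  have -> : diag_mx (map_mx GRing.inv h) *m A^T *m diag_mx (- l) *m (A *m diag_mx h) =
      - (diag_mx (map_mx GRing.inv h) *m (A^T *m diag_mx l *m A) *m diag_mx h).
    by rewrite linearN /= mulmxN mulNmx !mulmxA.
  rewrite -LE /laplacian -/h invmx_diag // mulmxN mulNmx opprK !mulmxA hh mul1mx.
  by rewrite -mulmxA hh mulmx1.
have Ct0 := @committor_ge0 _ _ _ _ P X I.
have CtI := committor_target chainX startX (I := I).
have CtH i j := @committor_harmonic _ _ _ _ P X Q chainX I startX _ _ _ VW QE i j.
have := compression_nuclear_norm_le t_gt0 (laplacian_psd rateQ statQ revQ)
  (green_psd rateQ irrQ statQ revQ I_gt0)
  (compression_defect_psd rateQ irrQ statQ revQ I_gt0 Ct0 CtI CtH)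
  (laplacian_compression statQ Ct0 CtI CtH)
  (laplacian_green_compression rateQ irrQ statQ revQ I_gt0 Ct0 CtI CtH)
  (compression_defect_le rateQ irrQ statQ revQ I_gt0 Ct0 CtI CtH) _.
rewrite -(nystrom_errorE rateQ irrQ statQ revQ I_gt0) => /(_ _)/le_trans; apply.
  eexists; last exact: (compressed_singular rateQ irrQ statQ revQ I_gt0 Ct0 CtI CtH).
  apply/eqP => /colP/(_ (Ordinal I_gt0)); rewrite !mxE => /eqP.
  by rewrite gt_eqF // sqrtr_gt0; have := weight_gt0 statQ Ct0 CtI (Ordinal I_gt0); rewrite mxE.
rewrite mulrC; apply: ler_wpM2r.
  rewrite divr_ge0 ?(ltW t_gt0) // (nystrom_errorE rateQ irrQ statQ revQ I_gt0).
  exact: psd_mxtrace_ge0 (green_psd rateQ irrQ statQ revQ I_gt0).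
have k1 := @expRN1_le R; have k0 := expR_ge0 (- 1 : R).
have k2 : expR (- 1) ^+ 2 <= (37 / 100) ^+ 2 :> R by rewrite lerXn2r ?nnegrE // divr_ge0.
have pi1 := @pi_le_16_5 R; have pi0 := @pi_gt0 R.
have s3 : 17 / 10 <= Num.sqrt 3 :> R.
  by rewrite -[leLHS]ger0_norm ?divr_ge0 // -sqrtr_sqr ler_sqrt //; lra.
have m1 : 1 <= #|I|%:R :> R by rewrite ler1n.
move: (@pi R) pi1 pi0 => p p1 p0.
have -> : 3 * Num.sqrt 3 / (2 * p) + #|I|%:R * (2 / p) =
    (3 * Num.sqrt 3 + 4 * #|I|%:R) / (2 * p) :> R.
  by field; rewrite gt_eqF.
rewrite ler_pdivlMr ?mulr_gt0 //.
(* At [|I| = 1] the comparison reads about 8.92 against 9.1, and the slopes in [|I|] are 3.2 and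
   4. *)
apply: (le_trans (y := (9 / 4 * (37 / 100) + 41 / 10 * (37 / 100) ^+ 2 + (#|I|%:R - 1) / 2) * (2 * (16 / 5)))).
  have k3 := sqr_ge0 (expR (- 1) : R).
  by apply: ler_pM; lra.
lra.
Qed.
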